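(* Consider a family of confocal focused hyperbolic conic sections on $\mathcal H_S$ (that is, sharing the same two foci, one of which is the South pole $(0,0,-1)$), expressed in the Poincar\'e disc $\mathcal D\subset\{z=0\}\cong\mathbb C$. Under the complex square mapping $\mathbb C\to\mathbb C$, $\zeta\mapsto\zeta^2$, by taking preimages (branch by branch), this family is transformed into a family of conic sections centered at the South pole and sharing the same two foci, both when $\mathcal D$ containing the preimages is regarded as part of the stereographic chart of the sphere (giving a confocal family of centered spherical conic sections on the southern hemisphere $\mathcal S_{SH}$), and when it is regarded as the Poincar\'e disc (giving a confocal family of centered hyperbolic conic sections).
   Context: $\mathcal H_S=\{(x,y,z)\in\mathbb R^{2,1}: x^2+y^2-z^2=-1,\ z<0\}$ is the lower sheet of the two-sheeted hyperboloid, with the hyperbolic metric induced by $dx^2+dy^2-dz^2$. $\mathcal S$ is the unit sphere in $\mathbb R^3$ with the round metric and $\mathcal S_{SH}=\mathcal S\cap\{z<0\}$. The plane $\{z=0\}$ is identified with $\mathbb C$. Stereographic projection from the North pole $(0,0,1)$ onto $\{z=0\}$ gives the stereographic chart of $\mathcal S$, in which the round metric is $\frac{4}{(1+|q|^2)^2}dq\,d\bar q$ and $\mathcal S_{SH}$ is the open unit disc. Projection of $\mathcal H_S$ from $(0,0,1)$ onto $\{z=0\}$ gives the Poincar\'e disc $\mathcal D=\{w\in\mathbb C:|w|<1\}$ with metric $\frac{4}{(1-|q|^2)^2}dq\,d\bar q$; in both models the South pole $(0,0,-1)$ corresponds to $0$. With $d$ the Riemannian distance (on the sphere or in the hyperbolic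 plane), conic sections with foci $F_1\ne F_2$ are the ellipses $\{d(q,F_1)+d(q,F_2)=c\}$ and the hyperbolas $\{|d(q,F_1)-d(q,F_2)|=c\}$, the branches of the latter being $\{d(q,F_1)-d(q,F_2)=c\}$ and $\{d(q,F_1)-d(q,F_2)=-c\}$. Conic sections are confocal if they share both foci; a conic section is focused if one focus is the South pole, and centered if the midpoint of its two foci is the South pole. Spherical conic sections in this statement are considered in $\mathcal S_{SH}$. *)

(* Defs.v *)
From Stdlib Require Import Reals.
From Coquelicot Require Import Coquelicot.
Open Scope R_scope.

Record R3 : Type := mkR3 { cx : R; cy : R; cz : R }.

(** * Riemannian distance on a surface of 3-space *)

Definition C1_function (f : R -> R) : Prop :=
  forall t : R, ex_derive f t /\ continuous (Derive f) t.

Definition C1_curve (gamma : R -> R3) : Prop :=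
  C1_function (fun t => cx (gamma t)) /\
  C1_function (fun t => cy (gamma t)) /\
  C1_function (fun t => cz (gamma t)).

Definition velocity (gamma : R -> R3) (t : R) : R3 :=
  mkR3 (Derive (fun s => cx (gamma s)) t)
       (Derive (fun s => cy (gamma s)) t)
       (Derive (fun s => cz (gamma s)) t).

Definition curve_length (Q : R3 -> R) (gamma : R -> R3) : R :=
  RInt (fun t => sqrt (Q (velocity gamma t))) 0 1.

(** Only the restriction to [[0,1]] of the curve matters: a C^1 curve on the
    segment always extends to a C^1 map from the line to 3-space, and the
    extension need not stay on the surface. *)
Definition joins (M : R3 -> Prop) (p q : R3) (gamma : R -> R3) : Prop :=
  C1_curve gamma /\ (forall t : R, 0 <= t <= 1 -> M (gamma t)) /\
  gamma 0 = p /\ gamma 1 = q.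

(** Distance of the metric induced on the surface [M] by the ambient
    quadratic form [Q] (required to be positive on the tangent planes of [M]):
    infimum of the lengths of the C^1 curves of [M] between the two points.
    Meaningful only for two points of a connected [M]. *)
Definition riemannian_dist (M : R3 -> Prop) (Q : R3 -> R) (p q : R3) : R :=
  real (Glb_Rbar (fun l : R =>
    exists gamma : R -> R3, joins M p q gamma /\ l = curve_length Q gamma)).

(** * The two surfaces and their common chart *)

Definition euclid_form (v : R3) : R := cx v ^ 2 + cy v ^ 2 + cz v ^ 2.
Definition minkowski_form (v : R3) : R := cx v ^ 2 + cy v ^ 2 - cz v ^ 2.

Definition sphere (p : R3) : Prop := euclid_form p = 1.
Definition south_hemisphere (p : R3) : Prop := sphere p /\ cz p < 0.
Definition hyperboloid (p : R3) : Prop := minkowski_form p = -1 /\ cz p < 0.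

Definition sphere_dist : R3 -> R3 -> R := riemannian_dist sphere euclid_form.
Definition hyp_dist : R3 -> R3 -> R := riemannian_dist hyperboloid minkowski_form.

Definition south_pole : R3 := mkR3 0 0 (-1).

(** Projection from [(0,0,1)] onto the plane [z = 0], identified with [C]: the
    stereographic projection on the sphere, and on the hyperboloid the
    projection onto the Poincare disc. *)
Definition proj (p : R3) : C := (cx p / (1 - cz p), cy p / (1 - cz p)).

Definition chart_image (A : R3 -> Prop) (w : C) : Prop :=
  exists p : R3, A p /\ proj p = w.

Definition square_preimage (A : C -> Prop) (zeta : C) : Prop :=
  A (Cmult zeta zeta).

(** * Conic sections *)

(** [M] is the part of the surface in which the conic section is considered;
    it may be smaller than the surface on which the distance [d] is taken. *)
Definition ellipse (M : R3 -> Prop) (d : R3 -> R3 -> R) (F1 F2 : R3) (c : R)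
    (q : R3) : Prop :=
  M q /\ d q F1 + d q F2 = c.

Definition hyperbola (M : R3 -> Prop) (d : R3 -> R3 -> R) (F1 F2 : R3) (c : R)
    (q : R3) : Prop :=
  M q /\ Rabs (d q F1 - d q F2) = c.

Definition hyperbola_branch_pos (M : R3 -> Prop) (d : R3 -> R3 -> R)
    (F1 F2 : R3) (c : R) (q : R3) : Prop :=
  M q /\ d q F1 - d q F2 = c.

Definition hyperbola_branch_neg (M : R3 -> Prop) (d : R3 -> R3 -> R)
    (F1 F2 : R3) (c : R) (q : R3) : Prop :=
  M q /\ d q F1 - d q F2 = - c.

Definition same_set {T : Type} (A B : T -> Prop) : Prop :=
  forall x : T, A x <-> B x.

Definition is_conic (M : R3 -> Prop) (d : R3 -> R3 -> R) (F1 F2 : R3)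
    (K : R3 -> Prop) : Prop :=
  exists c : R, same_set K (ellipse M d F1 F2 c) \/
                same_set K (hyperbola M d F1 F2 c).

(** Branches of the conic sections with foci [F1], [F2]: an ellipse is its own
    single branch; a hyperbola (nonempty only for [0 <= c]) has two. *)
Definition is_conic_branch (M : R3 -> Prop) (d : R3 -> R3 -> R) (F1 F2 : R3)
    (B : R3 -> Prop) : Prop :=
  exists c : R,
    same_set B (ellipse M d F1 F2 c) \/
    (0 <= c /\ (same_set B (hyperbola_branch_pos M d F1 F2 c) \/
                same_set B (hyperbola_branch_neg M d F1 F2 c))).

Definition focused (F1 F2 : R3) : Prop := F1 = south_pole \/ F2 = south_pole.

Definition is_midpoint (d : R3 -> R3 -> R) (P F1 F2 : R3) : Prop :=
  d P F1 = d F1 F2 / 2 /\ d P F2 = d F1 F2 / 2.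

Definition centered (d : R3 -> R3 -> R) (F1 F2 : R3) : Prop :=
  is_midpoint d south_pole F1 F2.

(* Main.v *)
Require Import Defs.
From Stdlib Require Import Reals Lra Psatz Classical.
From Coquelicot Require Import Coquelicot.
Open Scope R_scope.

(** The sphere distance is [acos] of the scalar product and the hyperbolic
    distance [arcosh] of minus the Minkowski product. Hence, for [w], [a] in the
    unit disc, [sinh (d/2)] and [cosh (d/2)] are proportional to [|w - a|] and
    [|1 - conj a * w|] in the hyperbolic metric, and [sin (d/2)] and [cos (d/2)]
    to [|w - a|] and [|1 + conj a * w|] in the spherical one. Let [w = z^2],
    [a = b^2], and let [d0], [da], [alpha] be the hyperbolic distances [d(w,0)],
    [d(w,a)], [d(a,0)]. Factoring [z^2 - b^2] and [1 - conj b^2 * z^2] gives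
    - hyperbolic: [cosh ((d(z,b) +- d(z,-b)) / 2) = exp ((d0 +- da + alpha) / 2)],
    - spherical:  [cos ((d(z,b) +- d(z,-b)) / 2) = exp (- (d0 +- da + alpha) / 2)].
    So on the disc [d0 +- da] and [|d(z,b) +- d(z,-b)|] have the same level sets. *)

(** * Distance on the sphere *)

Definition sphere_dot (p q : R3) : R := cx p * cx q + cy p * cy q + cz p * cz q.
Definition minkowski_dot (p q : R3) : R := cx p * cx q + cy p * cy q - cz p * cz q.

Lemma R3_eq (p q : R3) : cx p = cx q -> cy p = cy q -> cz p = cz q -> p = q.
Proof. destruct p, q; simpl; intros; subst; reflexivity. Qed.

(** * Curve lengths and distances for a general quadratic form *)

Lemma C1_curve_derive (gamma : R -> R3) (t : R) : C1_curve gamma ->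
  is_derive (fun s => cx (gamma s)) t (cx (velocity gamma t)) /\
  is_derive (fun s => cy (gamma s)) t (cy (velocity gamma t)) /\
  is_derive (fun s => cz (gamma s)) t (cz (velocity gamma t)).
Proof.
  intros [Hx [Hy Hz]]; split; [|split]; apply Derive_correct; [apply Hx|apply Hy|apply Hz].
Qed.

(** The parameter [s] covers both forms, with [s = 1] Euclidean and [s = -1] Minkowski. No sign of
    the radicand enters, because [sqrt] is continuous on the whole line, being 0 on negative
    numbers. *)
Lemma speed_continuous (s : R) (gamma : R -> R3) (t : R) : C1_curve gamma ->
  continuous (fun t => sqrt (cx (velocity gamma t) ^ 2 + cy (velocity gamma t) ^ 2
                             + s * cz (velocity gamma t) ^ 2)) t.
Proof.
  intros [Hx [Hy Hz]]; apply continuous_sqrt_comp; simpl.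
  destruct (Hx t) as [_ Cx], (Hy t) as [_ Cy], (Hz t) as [_ Cz].
  assert (Hsq : forall f : R -> R, continuous f t -> continuous (fun u => f u * (f u * 1)) t).
  { intros f Hf. apply (@continuous_mult R_UniformSpace R_AbsRing f (fun u => f u * 1) t Hf).
    apply (@continuous_mult R_UniformSpace R_AbsRing f (fun _ => 1) t Hf), continuous_const. }
  apply (@continuous_plus R_UniformSpace R_AbsRing R_NormedModule
    (fun t => cx (velocity gamma t) ^ 2 + cy (velocity gamma t) ^ 2) (fun t => s * cz (velocity gamma t) ^ 2)).
  - apply (@continuous_plus R_UniformSpace R_AbsRing R_NormedModule
      (fun t => cx (velocity gamma t) ^ 2) (fun t => cy (velocity gamma t) ^ 2)).
    + exact (Hsq _ Cx).
    + exact (Hsq _ Cy).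
  - apply (@continuous_mult R_UniformSpace R_AbsRing (fun _ => s) (fun t => cz (velocity gamma t) ^ 2));
      [apply continuous_const | exact (Hsq _ Cz)].
Qed.

Lemma euclid_speed_continuous (gamma : R -> R3) (t : R) : C1_curve gamma ->
  continuous (fun t => sqrt (euclid_form (velocity gamma t))) t.
Proof.
  intro HC. apply (continuous_ext (fun t => sqrt (cx (velocity gamma t) ^ 2
    + cy (velocity gamma t) ^ 2 + 1 * cz (velocity gamma t) ^ 2))).
  - intro s; unfold euclid_form; now rewrite Rmult_1_l.
  - now apply speed_continuous.
Qed.

Lemma minkowski_speed_continuous (gamma : R -> R3) (t : R) : C1_curve gamma ->
  continuous (fun t => sqrt (minkowski_form (velocity gamma t))) t.
Proof.
  intro HC. apply (continuous_ext (fun t => sqrt (cx (velocity gamma t) ^ 2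
    + cy (velocity gamma t) ^ 2 + (-1) * cz (velocity gamma t) ^ 2))).
  - intro s; unfold minkowski_form; f_equal; ring.
  - now apply speed_continuous.
Qed.

(** Calibration: [f] minus the arc length has nonpositive derivative, so the mean value theorem
    bounds the increase of [f]. With [f] the candidate distance from the starting point, this gives
    the lower bounds on lengths. *)
Lemma derive_le_curve_length (Q : R3 -> R) (gamma : R -> R3) (f f' : R -> R) :
  (forall t, continuous (fun t => sqrt (Q (velocity gamma t))) t) ->
  (forall t, 0 <= t <= 1 -> is_derive f t (f' t)) ->
  (forall t, 0 < t < 1 -> f' t <= sqrt (Q (velocity gamma t))) ->
  f 1 - f 0 <= curve_length Q gamma.
Proof.
  intros Hc Hf Hle.
  set (v := fun t => sqrt (Q (velocity gamma t))) in *.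
  assert (Hv : forall t, is_derive (RInt v 0) t (v t)).
  { intro t. apply (@is_derive_RInt R_NormedModule v (RInt v 0) 0 t); [|apply Hc].
    apply filter_forall; intro b. apply (@RInt_correct R_CompleteNormedModule).
    apply (ex_RInt_continuous (V := R_CompleteNormedModule)); intros; apply Hc. }
  destruct (MVT_cor2 (fun t => f t - RInt v 0 t) (fun t => f' t - v t) 0 1) as [c [E Hc1]].
  - lra.
  - intros c Hc1. apply is_derive_Reals. apply (is_derive_minus f (RInt v 0)); auto.
  - specialize (Hle c Hc1). rewrite RInt_point in E. change (zero : R) with 0 in E.
    change (curve_length Q gamma) with (RInt v 0 1). fold (v c) in Hle. lra.
Qed.

Lemma curve_length_nonneg (Q : R3 -> R) (gamma : R -> R3) :
  (forall t, continuous (fun t => sqrt (Q (velocity gamma t))) t) -> 0 <= curve_length Q gamma.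
Proof.
  intro Hc. apply RInt_ge_0; [lra| |intros; apply sqrt_pos].
  apply (ex_RInt_continuous (V := R_CompleteNormedModule)); intros; apply Hc.
Qed.

(** An attained lower bound is the infimum. Each distance formula thus splits into a geodesic and a
    lower bound on lengths. *)
Lemma riemannian_dist_minimizer (M : R3 -> Prop) (Q : R3 -> R) (p q : R3) (l : R) :
  (exists gamma, joins M p q gamma /\ l = curve_length Q gamma) ->
  (forall gamma, joins M p q gamma -> l <= curve_length Q gamma) ->
  riemannian_dist M Q p q = l.
Proof.
  intros Hex Hlow. unfold riemannian_dist.
  rewrite (is_glb_Rbar_unique _ (Finite l)); [reflexivity|]. split.
  - intros x [g [Hg ->]]. apply Hlow, Hg.
  - intros b Hb. apply (Hb l Hex).
Qed.

Lemma constant_speed_length (Q : R3 -> R) (gamma : R -> R3) (l : R) : 0 <= l ->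
  (forall t, Q (velocity gamma t) = l ^ 2) -> curve_length Q gamma = l.
Proof.
  intros Hl HQ. unfold curve_length.
  rewrite (RInt_ext _ (fun _ => l)).
  - rewrite RInt_const. unfold scal; simpl; unfold mult; simpl; ring.
  - intros t _. rewrite HQ. now apply sqrt_pow2.
Qed.

(** A curve may leave the surface outside the segment, so its equation can be differentiated only at
    interior times, which have a neighbourhood inside the segment. *)
Lemma derive_zero_of_constant (f : R -> R) (t a l : R) : 0 < t < 1 ->
  (forall s, 0 <= s <= 1 -> f s = a) -> is_derive f t l -> l = 0.
Proof.
  intros Ht Hf Hd.
  rewrite <- (is_derive_unique f t l Hd).
  rewrite (Derive_ext_loc f (fun _ => a)); [apply Derive_const|].
  apply (locally_interval _ t 0 1); simpl; try lra.
  intros y H0 H1. apply Hf; lra.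
Qed.

(** Cauchy-Schwarz in the tangent plane at [x] comes from the Gram determinant
    of [x], [v], [p], which is the square of their determinant. *)
Lemma sphere_gram (x v p : R3) :
  sphere x -> sphere p -> sphere_dot x v = 0 ->
  sphere_dot v p ^ 2 <= euclid_form v * (1 - sphere_dot x p ^ 2).
Proof.
  unfold sphere, euclid_form, sphere_dot; destruct x as [a b c], v as [d e f], p as [g h i]; simpl.
  intros Hx Hp Hv.
  set (X := a * (a*1) + b * (b*1) + c * (c*1)) in *.
  set (P := g * (g*1) + h * (h*1) + i * (i*1)) in *.
  set (V := d * (d*1) + e * (e*1) + f * (f*1)).
  set (D := a * (e * i - f * h) - b * (d * i - f * g) + c * (d * h - e * g)).
  assert (HD : D ^ 2 = X * V * P + 2 * (a*d+b*e+c*f) * (d*g+e*h+f*i) * (a*g+b*h+c*i)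
     - X * (d*g+e*h+f*i)^2 - V * (a*g+b*h+c*i)^2 - P * (a*d+b*e+c*f)^2)
    by (unfold D, X, V, P; ring).
  rewrite Hx, Hp, Hv in HD. pose proof (pow2_ge_0 D). nra.
Qed.

(** In the Minkowski signature the Gram determinant of [x], [v], [p] is minus the square of their
    determinant; together with the two values -1 this reverses the bound. *)
Lemma minkowski_gram (x v p : R3) :
  minkowski_form x = -1 -> minkowski_form p = -1 -> minkowski_dot x v = 0 ->
  minkowski_dot v p ^ 2 <= minkowski_form v * (minkowski_dot x p ^ 2 - 1).
Proof.
  unfold minkowski_form, minkowski_dot; destruct x as [a b c], v as [d e f], p as [g h i]; simpl.
  intros Hx Hp Hv.
  set (X := a * (a*1) + b * (b*1) - c * (c*1)) in *.
  set (P := g * (g*1) + h * (h*1) - i * (i*1)) in *.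
  set (V := d * (d*1) + e * (e*1) - f * (f*1)).
  set (D := a * (e * i - f * h) - b * (d * i - f * g) + c * (d * h - e * g)).
  assert (HD : - D ^ 2 = X * V * P + 2 * (a*d+b*e-c*f) * (d*g+e*h-f*i) * (a*g+b*h-c*i)
     - X * (d*g+e*h-f*i)^2 - V * (a*g+b*h-c*i)^2 - P * (a*d+b*e-c*f)^2)
    by (unfold D, X, V, P; ring).
  rewrite Hx, Hp, Hv in HD. pose proof (pow2_ge_0 D). nra.
Qed.

(** * Great-circle distance *)

Lemma sphere_dot_bound (p q : R3) : sphere p -> sphere q -> -1 <= sphere_dot p q <= 1.
Proof.
  unfold sphere, euclid_form, sphere_dot; destruct p as [a b c], q as [d e f]; simpl.
  intros. pose proof (pow2_ge_0 (a-d)); pose proof (pow2_ge_0 (b-e)); pose proof (pow2_ge_0 (c-f)).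
  pose proof (pow2_ge_0 (a+d)); pose proof (pow2_ge_0 (b+e)); pose proof (pow2_ge_0 (c+f)). nra.
Qed.

(** The angle from [p] to [gamma t] grows no faster than arc length, by the Gram inequality at
    [gamma t]. *)
Lemma sphere_length_ge (p q : R3) (gamma : R -> R3) : sphere p -> sphere q ->
  joins sphere p q gamma -> acos (sphere_dot p q) <= curve_length euclid_form gamma.
Proof.
  intros Hp Hq [HC [HM [H0 H1]]].
  set (u := fun t => sphere_dot p (gamma t)).
  set (u' := fun t => sphere_dot p (velocity gamma t)).
  assert (Hu : forall t, is_derive u t (u' t)).
  { intro t. destruct (C1_curve_derive gamma t HC) as [Dx [Dy Dz]].
    unfold u, u', sphere_dot.
    apply (is_derive_plus (V := R_NormedModule)); [apply (is_derive_plus (V := R_NormedModule))|];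
      apply is_derive_scal; assumption. }
  assert (Hub : forall t, 0 <= t <= 1 -> -1 <= u t <= 1)
    by (intros t Ht; apply sphere_dot_bound; auto).
  assert (Htan : forall t, 0 < t < 1 -> sphere_dot (gamma t) (velocity gamma t) = 0).
  { intros t Ht. destruct (C1_curve_derive gamma t HC) as [Dx [Dy Dz]].
    enough (E : 2 * sphere_dot (gamma t) (velocity gamma t) = 0) by lra.
    apply (derive_zero_of_constant (fun t => euclid_form (gamma t)) t 1); [exact Ht|exact HM|].
    unfold euclid_form.
    evar_last.
    - apply (is_derive_plus (V := R_NormedModule)); [apply (is_derive_plus (V := R_NormedModule))|];
      apply is_derive_pow; eassumption.
    - unfold plus, sphere_dot; simpl; ring. }
  (* [acos] is not differentiable at [u 0 = 1], so [u] is first scaled by [k < 1],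
     which keeps the derivative bounded by the speed. *)
  assert (Hk : forall k, 0 < k < 1 ->
    acos (k * u 1) - acos (k * u 0) <= curve_length euclid_form gamma).
  { intros k Hk.
    assert (Hin : forall t, 0 <= t <= 1 -> -1 < k * u t < 1)
      by (intros t Ht; specialize (Hub t Ht); nra).
    apply (derive_le_curve_length euclid_form gamma (fun t => acos (k * u t))
      (fun t => (k * u' t) * (-1 / sqrt (1 - (k * u t)²)))).
    - intro t. now apply euclid_speed_continuous.
    - intros t Ht.
      apply (is_derive_comp acos (fun t => k * u t)).
      + apply is_derive_Reals. rewrite <- (derive_pt_acos _ (Hin t Ht)).
        apply derive_pt_eq_1 with (derivable_pt_acos _ (Hin t Ht)). reflexivity.
      + apply is_derive_scal, Hu.
    - intros t Ht.
      assert (Ht' : 0 <= t <= 1) by lra.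
      specialize (Hub t Ht'); specialize (Hin t Ht').
      assert (G := sphere_gram (gamma t) (velocity gamma t) p (HM t Ht') Hp (Htan t Ht)).
      assert (E1 : sphere_dot (gamma t) p = u t) by (unfold u, sphere_dot; ring).
      assert (E2 : sphere_dot (velocity gamma t) p = u' t) by (unfold u', sphere_dot; ring).
      rewrite E1, E2 in G.
      set (V := euclid_form (velocity gamma t)) in *.
      assert (HV : 0 <= V) by (unfold V, euclid_form; nra).
      assert (Hpos : 0 < 1 - (k * u t)²) by (unfold Rsqr; nra).
      assert (Hs := sqrt_lt_R0 _ Hpos).
      (* In squares: [k^2 u'^2 <= k^2 V (1 - u^2) <= V (1 - k^2 u^2)], as [k^2 <= 1]. *)
      assert (Hle : Rabs (k * u' t) <= sqrt V * sqrt (1 - (k * u t)²)).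
      { rewrite <- sqrt_mult_alt by exact HV. rewrite <- sqrt_Rsqr_abs.
        apply sqrt_le_1_alt. unfold Rsqr.
        assert (k * k <= 1) by nra.
        assert (0 <= V * (1 - k * k)) by (apply Rmult_le_pos; lra).
        assert (k * k * u' t ^ 2 <= k * k * (V * (1 - u t ^ 2)))
          by (apply Rmult_le_compat_l; [nra|exact G]).
        nra. }
      replace (k * u' t * (-1 / sqrt (1 - (k * u t)²)))
        with ((- (k * u' t)) / sqrt (1 - (k * u t)²)) by (field; lra).
      apply Rle_div_l; [exact Hs|]. eapply Rle_trans; [apply Rle_abs|].
      rewrite Rabs_Ropp. exact Hle. }
  assert (U1 : u 1 = sphere_dot p q) by (unfold u; now rewrite H1).
  assert (U0 : u 0 = 1).
  { unfold u; rewrite H0. unfold sphere, euclid_form in Hp; unfold sphere_dot. rewrite <- Hp; ring. }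
  rewrite <- U1. set (L := curve_length euclid_form gamma) in *.
  assert (Hub1 := Hub 1 ltac:(lra)).
  set (th := acos (u 1)) in *.
  assert (Hth : 0 <= th <= PI) by apply acos_bound.
  assert (Cth : cos th = u 1) by now apply cos_acos.
  assert (HPI := PI_RGT_0).
  assert (HL : 0 <= L) by (apply curve_length_nonneg; intro; now apply euclid_speed_continuous).
  apply le_epsilon. intros eps Heps.
  (* A small angle is bounded by [eps] alone, since lengths are nonnegative. Otherwise take
     [k = cos eta], for which [acos (k * u 0)] is exactly [eta]. *)
  destruct (Rle_lt_dec th eps) as [|Hlt]; [lra|].
  set (eta := eps / 2).
  assert (He : 0 < eta /\ eta <= PI / 2 /\ eta <= th) by (unfold eta; lra).
  assert (Hc0 : 0 < cos eta) by (apply cos_gt_0; unfold eta; lra).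
  assert (Hc1 : cos eta < 1) by (rewrite <- cos_0; apply cos_decreasing_1; lra).
  specialize (Hk (cos eta) (conj Hc0 Hc1)).
  rewrite U0, Rmult_1_r, acos_cos in Hk by lra.
  (* Comparing cosines, [cos (th - eta)] exceeds [cos eta * cos th] by [sin th * sin eta >= 0]. The
     loss [eta] occurs at both ends, whence [eta = eps / 2]. *)
  enough (th - eta <= acos (cos eta * u 1)) by (unfold eta in *; lra).
  assert (HB := acos_bound (cos eta * u 1)).
  apply cos_decr_0; try lra.
  rewrite cos_acos by nra. rewrite cos_minus, Cth.
  assert (0 <= sin th) by (apply sin_ge_0; lra).
  assert (0 <= sin eta) by (apply sin_ge_0; lra). nra.
Qed.

(** The great-circle arc [cos (th t) p + sin (th t) e], with [e] a unit tangent vector at [p], has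
    constant speed [th]. Antipodal points are excluded: the part of [q] orthogonal to [p] then
    vanishes and gives no direction [e]. *)
Lemma sphere_geodesic (p q : R3) : sphere p -> sphere q -> -1 < sphere_dot p q ->
  exists gamma, joins sphere p q gamma /\ acos (sphere_dot p q) = curve_length euclid_form gamma.
Proof.
  intros Hp Hq Hgt.
  destruct (sphere_dot_bound p q Hp Hq) as [_ Hle].
  set (c := sphere_dot p q) in *. set (th := acos c).
  assert (Hth : 0 <= th <= PI) by apply acos_bound.
  assert (Cth : cos th = c) by (apply cos_acos; lra).
  assert (He : exists e, sphere e /\ sphere_dot p e = 0 /\
     cx q = cos th * cx p + sin th * cx e /\ cy q = cos th * cy p + sin th * cy e /\
     cz q = cos th * cz p + sin th * cz e).
  { destruct (Rle_lt_or_eq_dec _ _ Hle) as [Hlt|Heq].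
    - assert (Hs : 0 < sin th).
      { apply sin_gt_0.
        - destruct (Rle_lt_or_eq_dec 0 th (proj1 Hth)) as [|E]; [assumption|].
          rewrite <- E, cos_0 in Cth; lra.
        - destruct (Rle_lt_or_eq_dec th PI (proj2 Hth)) as [|E]; [assumption|].
          rewrite E, cos_PI in Cth; lra. }
      assert (Hs2 := sin2_cos2 th). rewrite Cth in Hs2 |- *. unfold Rsqr in Hs2.
      set (s := sin th) in *.
      (* Gram-Schmidt: the part of [q] orthogonal to [p], whose norm is [s = sin th]. *)
      exists (mkR3 ((cx q - c * cx p) / s) ((cy q - c * cy p) / s) ((cz q - c * cz p) / s)).
      unfold sphere, euclid_form in *; unfold sphere_dot in *; simpl cx; simpl cy; simpl cz.
      repeat split; try (field; lra).
      + replace (((cx q - c * cx p) / s) ^ 2 + ((cy q - c * cy p) / s) ^ 2 + ((cz q - c * cz p) / s) ^ 2)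
          with ((cx q ^ 2 + cy q ^ 2 + cz q ^ 2 - 2 * c * (cx p * cx q + cy p * cy q + cz p * cz q)
             + c ^ 2 * (cx p ^ 2 + cy p ^ 2 + cz p ^ 2)) / (s * s)) by (field; lra).
        rewrite Hp, Hq. fold c. replace (s * s) with (1 - c * c) by lra.
        field. nra.
      + replace (cx p * ((cx q - c * cx p) / s) + cy p * ((cy q - c * cy p) / s) + cz p * ((cz q - c * cz p) / s))
          with ((cx p * cx q + cy p * cy q + cz p * cz q - c * (cx p ^ 2 + cy p ^ 2 + cz p ^ 2)) / s)
          by (field; lra).
        rewrite Hp. fold c. field; lra.
    - assert (p = q).
      { unfold c, sphere_dot in Heq; unfold sphere, euclid_form in *.
        assert (E : (cx p - cx q)² + (cy p - cy q)² + (cz p - cz q)² = 0) by (unfold Rsqr; nra).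
        pose proof (Rle_0_sqr (cx p - cx q)); pose proof (Rle_0_sqr (cy p - cy q));
        pose proof (Rle_0_sqr (cz p - cz q)).
        apply R3_eq; apply Rminus_diag_uniq, Rsqr_0_uniq; lra. }
      subst q.
      assert (T0 : th = 0) by (unfold th; rewrite Heq; apply acos_1).
      rewrite T0, cos_0, sin_0.
      (* any unit vector orthogonal to [p] does *)
      destruct (Req_dec (cx p ^ 2 + cy p ^ 2) 0) as [E|E].
      + exists (mkR3 1 0 0). unfold sphere, euclid_form, sphere_dot; simpl.
        assert (cx p = 0) by nra. repeat split; lra.
      + set (r := sqrt (cx p ^ 2 + cy p ^ 2)).
        assert (Hr : r * r = cx p ^ 2 + cy p ^ 2) by (apply sqrt_sqrt; nra).
        assert (r <> 0) by (intro Z; rewrite Z in Hr; lra).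
        exists (mkR3 (- cy p / r) (cx p / r) 0).
        unfold sphere, euclid_form, sphere_dot; simpl cx; simpl cy; simpl cz.
        repeat split; try (field; lra); try lra.
        replace ((- cy p / r) ^ 2 + (cx p / r) ^ 2 + 0 ^ 2) with ((cx p ^ 2 + cy p ^ 2) / (r * r))
          by (field; lra).
        rewrite Hr. field; lra. }
  destruct He as [e [He1 [He2 [Ex [Ey Ez]]]]].
  exists (fun t => mkR3 (cos (th * t) * cx p + sin (th * t) * cx e)
                (cos (th * t) * cy p + sin (th * t) * cy e)
                (cos (th * t) * cz p + sin (th * t) * cz e)).
  assert (Hd : forall a b t, is_derive (fun t => cos (th * t) * a + sin (th * t) * b) t
     (th * (- sin (th * t) * a + cos (th * t) * b)))
    by (intros; auto_derive; [exact I|ring]).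
  assert (HD : forall a b t, Derive (fun t => cos (th * t) * a + sin (th * t) * b) t =
     th * (- sin (th * t) * a + cos (th * t) * b))
    by (intros; apply is_derive_unique, Hd).
  assert (HC1 : forall a b, C1_function (fun t => cos (th * t) * a + sin (th * t) * b)).
  { intros a b t. split; [eexists; apply Hd|].
    eapply continuous_ext; [intro; symmetry; apply HD|].
    apply (ex_derive_continuous (V := R_NormedModule)). auto_derive. exact I. }
  unfold sphere, euclid_form in Hp, He1; unfold sphere_dot in He2.
  split; [split; [|split; [|split]]|].
  - split; [|split]; apply HC1.
  - intros t _. unfold sphere, euclid_form; simpl cx; simpl cy; simpl cz.
    assert (S := sin2_cos2 (th * t)). unfold Rsqr in S.
    set (co := cos (th * t)) in *; set (si := sin (th * t)) in *.
    transitivity (co * co * (cx p ^ 2 + cy p ^ 2 + cz p ^ 2) + si * si * (cx e ^ 2 + cy e ^ 2 + cz e ^ 2)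
      + 2 * co * si * (cx p * cx e + cy p * cy e + cz p * cz e)); [ring|].
    rewrite Hp, He1, He2. lra.
  - rewrite Rmult_0_r, cos_0, sin_0. apply R3_eq; simpl; ring.
  - rewrite Rmult_1_r. apply R3_eq; simpl; congruence.
  - symmetry. apply constant_speed_length; [apply Hth|].
    intro t. unfold velocity, euclid_form; simpl cx; simpl cy; simpl cz. rewrite !HD.
    assert (S := sin2_cos2 (th * t)). unfold Rsqr in S.
    set (co := cos (th * t)) in *; set (si := sin (th * t)) in *.
    transitivity (th ^ 2 * (si * si * (cx p ^ 2 + cy p ^ 2 + cz p ^ 2) + co * co * (cx e ^ 2 + cy e ^ 2 + cz e ^ 2)
      - 2 * co * si * (cx p * cx e + cy p * cy e + cz p * cz e))); [ring|].
    rewrite Hp, He1, He2. replace (si*si*1+co*co*1 - 2*co*si*0) with 1 by lra. ring.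
Qed.

Lemma sphere_dist_acos (p q : R3) : sphere p -> sphere q -> -1 < sphere_dot p q ->
  sphere_dist p q = acos (sphere_dot p q).
Proof.
  intros Hp Hq H. apply riemannian_dist_minimizer.
  - now apply sphere_geodesic.
  - intros; now apply sphere_length_ge.
Qed.

(** * Distance on the hyperboloid *)

Lemma cosh_sinh_exp (x : R) : cosh x + sinh x = exp x.
Proof. unfold cosh, sinh; field. Qed.

Lemma cosh_sinh_exp_opp (x : R) : cosh x - sinh x = exp (- x).
Proof. unfold cosh, sinh; field. Qed.

Lemma cosh2_sinh2 (x : R) : cosh x ^ 2 - sinh x ^ 2 = 1.
Proof.
  replace (cosh x ^ 2 - sinh x ^ 2) with ((cosh x + sinh x) * (cosh x - sinh x)) by ring.
  rewrite cosh_sinh_exp, cosh_sinh_exp_opp, <- exp_plus, Rplus_opp_r. apply exp_0.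
Qed.

Lemma cosh_add (x y : R) : cosh (x + y) = cosh x * cosh y + sinh x * sinh y.
Proof. unfold cosh, sinh. rewrite Ropp_plus_distr, !exp_plus; field. Qed.

Lemma cosh_opp (x : R) : cosh (- x) = cosh x.
Proof. unfold cosh. rewrite Ropp_involutive; field. Qed.

Lemma sinh_opp (x : R) : sinh (- x) = - sinh x.
Proof. unfold sinh. rewrite Ropp_involutive; field. Qed.

Lemma cosh_sub (x y : R) : cosh (x - y) = cosh x * cosh y - sinh x * sinh y.
Proof. unfold Rminus at 1. rewrite cosh_add, cosh_opp, sinh_opp; ring. Qed.

Lemma cosh_pos (x : R) : 0 < cosh x.
Proof. unfold cosh. pose proof (exp_pos x); pose proof (exp_pos (- x)); lra. Qed.

Lemma cosh_ge_1 (x : R) : 1 <= cosh x.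
Proof. pose proof (cosh2_sinh2 x); pose proof (cosh_pos x); nra. Qed.

Lemma sinh_nonneg (x : R) : 0 <= x -> 0 <= sinh x.
Proof. intros [H| <-]; [rewrite <- sinh_0; left; now apply sinh_lt | rewrite sinh_0; lra]. Qed.

Lemma cosh_lt (x y : R) : 0 <= x -> x < y -> cosh x < cosh y.
Proof.
  intros Hx Hxy. pose proof (cosh2_sinh2 x); pose proof (cosh2_sinh2 y).
  pose proof (cosh_pos x); pose proof (cosh_pos y).
  pose proof (sinh_nonneg x Hx); pose proof (sinh_lt x y Hxy). nra.
Qed.

Lemma cosh_le_inv (x y : R) : 0 <= y -> cosh x <= cosh y -> x <= y.
Proof.
  intros Hy H. destruct (Rle_lt_dec x y) as [|Hlt]; [assumption|].
  pose proof (cosh_lt y x Hy Hlt); lra.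
Qed.

Lemma cosh_inj (x y : R) : 0 <= x -> 0 <= y -> cosh x = cosh y -> x = y.
Proof. intros; apply Rle_antisym; apply cosh_le_inv; lra. Qed.

(** The argument of [ln] is the larger root of [y + 1/y = 2 x], the equation [cosh (ln y) = x]; this
    is meaningful for [x >= 1]. *)
Definition arcosh (x : R) : R := ln (x + sqrt (x ^ 2 - 1)).

Lemma cosh_arcosh (x : R) : 1 <= x -> cosh (arcosh x) = x.
Proof.
  intro Hx. assert (S := sqrt_sqrt (x ^ 2 - 1) ltac:(nra)).
  assert (P := sqrt_pos (x ^ 2 - 1)).
  unfold cosh, arcosh. set (s := sqrt (x ^ 2 - 1)) in *.
  rewrite exp_Ropp, exp_ln by lra.
  replace (/ (x + s)) with (x - s); [field|].
  field_simplify_eq; nra.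
Qed.

Lemma arcosh_nonneg (x : R) : 1 <= x -> 0 <= arcosh x.
Proof.
  intro Hx. unfold arcosh. rewrite <- ln_1.
  pose proof (sqrt_pos (x ^ 2 - 1)). apply ln_le; lra.
Qed.

Lemma arcosh_cosh (x : R) : 0 <= x -> arcosh (cosh x) = x.
Proof.
  intro Hx. pose proof (cosh_ge_1 x).
  apply cosh_inj; [now apply arcosh_nonneg | exact Hx | now apply cosh_arcosh].
Qed.

Lemma is_derive_arcosh (x : R) : 1 < x -> is_derive arcosh x (1 / sqrt (x ^ 2 - 1)).
Proof.
  intro Hx. unfold arcosh. pose proof (sqrt_lt_R0 (x ^ 2 - 1) ltac:(nra)).
  auto_derive; [simpl in *; repeat split; [nra|]; unfold Rminus in *; lra|].
  replace (x * (x * 1) + -(1)) with (x ^ 2 - 1) by ring.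
  field; split; lra.
Qed.

(** Reversed Cauchy-Schwarz. The identity [E] writes [(cz p * cz q)^2] as [(1 + m)^2] plus three
    squares; on the lower sheet [cz p * cz q] is positive, so square roots may be compared. Equality
    kills the three squares. *)
Lemma minkowski_dot_bound (p q : R3) : hyperboloid p -> hyperboloid q ->
  1 <= - minkowski_dot p q /\ (minkowski_dot p q = -1 -> p = q).
Proof.
  intros [Hp Hpz] [Hq Hqz]. unfold minkowski_form in *; unfold minkowski_dot.
  set (m := cx p * cx q + cy p * cy q).
  assert (E : (1 + m) ^ 2 + ((cx p - cx q) ^ 2 + (cy p - cy q) ^ 2
     + (cx p * cy q - cy p * cx q) ^ 2) = (cz p * cz q) ^ 2).
  { unfold m. replace ((cz p * cz q) ^ 2) with (cz p ^ 2 * cz q ^ 2) by ring.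
    replace (cz p ^ 2) with (1 + cx p ^ 2 + cy p ^ 2) by lra.
    replace (cz q ^ 2) with (1 + cx q ^ 2 + cy q ^ 2) by lra. ring. }
  pose proof (pow2_ge_0 (cx p - cx q)); pose proof (pow2_ge_0 (cy p - cy q)).
  pose proof (pow2_ge_0 (cx p * cy q - cy p * cx q)).
  assert (0 < cz p * cz q) by nra.
  split.
  - assert (1 + m <= cz p * cz q); [|lra].
    nra.
  - intro Heq. replace (cz p * cz q) with (1 + m) in E by lra.
    assert (X : cx p = cx q) by nra. assert (Y : cy p = cy q) by nra.
    apply R3_eq; try assumption. rewrite X, Y in Hp. nra.
Qed.

(** The calibration argument again, with [arcosh] for [acos] and the reversed Gram inequality. *)
Lemma hyperboloid_length_ge (p q : R3) (gamma : R -> R3) : hyperboloid p -> hyperboloid q ->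
  joins hyperboloid p q gamma -> arcosh (- minkowski_dot p q) <= curve_length minkowski_form gamma.
Proof.
  intros Hp Hq [HC [HM [H0 H1]]].
  set (u := fun t => - minkowski_dot p (gamma t)).
  set (u' := fun t => - minkowski_dot p (velocity gamma t)).
  assert (Hu : forall t, is_derive u t (u' t)).
  { intro t. destruct (C1_curve_derive gamma t HC) as [Dx [Dy Dz]].
    unfold u, u', minkowski_dot. apply (is_derive_opp (V := R_NormedModule)).
    apply (is_derive_minus (V := R_NormedModule)); [apply (is_derive_plus (V := R_NormedModule))|];
      apply is_derive_scal; assumption. }
  assert (Hub : forall t, 0 <= t <= 1 -> 1 <= u t)
    by (intros t Ht; apply minkowski_dot_bound; auto).
  assert (Htan : forall t, 0 < t < 1 -> minkowski_dot (gamma t) (velocity gamma t) = 0).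
  { intros t Ht. destruct (C1_curve_derive gamma t HC) as [Dx [Dy Dz]].
    enough (E : 2 * minkowski_dot (gamma t) (velocity gamma t) = 0) by lra.
    apply (derive_zero_of_constant (fun t => minkowski_form (gamma t)) t (-1)); [exact Ht|apply HM|].
    unfold minkowski_form.
    evar_last.
    - apply (is_derive_minus (V := R_NormedModule)); [apply (is_derive_plus (V := R_NormedModule))|];
      apply is_derive_pow; eassumption.
    - unfold minus, plus, opp, minkowski_dot; simpl; ring. }
  (* As on the sphere, scaling by [k > 1] avoids the singularity of [arcosh] at [u 0 = 1]. *)
  assert (Hk : forall k, 1 < k ->
    arcosh (k * u 1) - arcosh (k * u 0) <= curve_length minkowski_form gamma).
  { intros k Hk.
    assert (Hin : forall t, 0 <= t <= 1 -> 1 < k * u t)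
      by (intros t Ht; specialize (Hub t Ht); nra).
    apply (derive_le_curve_length minkowski_form gamma (fun t => arcosh (k * u t))
      (fun t => (k * u' t) * (1 / sqrt ((k * u t) ^ 2 - 1)))).
    - intro t. now apply minkowski_speed_continuous.
    - intros t Ht.
      apply (is_derive_comp arcosh (fun t => k * u t)).
      + apply is_derive_arcosh, Hin, Ht.
      + apply is_derive_scal, Hu.
    - intros t Ht.
      assert (Ht' : 0 <= t <= 1) by lra.
      specialize (Hub t Ht'); specialize (Hin t Ht').
      assert (G := minkowski_gram (gamma t) (velocity gamma t) p (proj1 (HM t Ht')) (proj1 Hp) (Htan t Ht)).
      assert (E1 : minkowski_dot (gamma t) p = - u t) by (unfold u, minkowski_dot; ring).
      assert (E2 : minkowski_dot (velocity gamma t) p = - u' t) by (unfold u', minkowski_dot; ring).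
      rewrite E1, E2 in G.
      set (V := minkowski_form (velocity gamma t)) in *.
      assert (Hpos : 0 < (k * u t) ^ 2 - 1) by nra.
      assert (Hs := sqrt_lt_R0 _ Hpos).
      replace (k * u' t * (1 / sqrt ((k * u t) ^ 2 - 1)))
        with ((k * u' t) / sqrt ((k * u t) ^ 2 - 1)) by (field; lra).
      apply Rle_div_l; [exact Hs|].
      assert (Hu2 : 0 <= u t ^ 2 - 1) by nra.
      assert (Hkk : 0 <= k ^ 2 * (u t ^ 2 - 1)) by nra.
      (* The first inequality is the Gram bound times [k^2]; the second is
         [k^2 (u^2 - 1) <= (k u)^2 - 1], as [k > 1]. *)
      apply Rle_trans with (sqrt (k ^ 2 * (u t ^ 2 - 1)) * sqrt V).
      + rewrite <- sqrt_mult_alt by exact Hkk.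
        eapply Rle_trans; [apply Rle_abs|]. rewrite <- sqrt_Rsqr_abs.
        apply sqrt_le_1_alt. unfold Rsqr.
        assert (0 <= k ^ 2) by apply pow2_ge_0.
        assert (k ^ 2 * (- u' t) ^ 2 <= k ^ 2 * (V * ((- u t) ^ 2 - 1)))
          by (apply Rmult_le_compat_l; assumption).
        lra.
      + rewrite Rmult_comm. apply Rmult_le_compat_l; [apply sqrt_pos|].
        apply sqrt_le_1_alt. nra. }
  assert (U1 : u 1 = - minkowski_dot p q) by (unfold u; now rewrite H1).
  assert (U0 : u 0 = 1).
  { unfold u; rewrite H0. destruct Hp as [Hp _].
    unfold minkowski_form in Hp; unfold minkowski_dot. lra. }
  rewrite <- U1. set (L := curve_length minkowski_form gamma) in *.
  assert (Hub1 := Hub 1 ltac:(lra)).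
  apply le_epsilon. intros eta Heta.
  assert (Hc : 1 < cosh eta) by (rewrite <- cosh_0; apply cosh_lt; lra).
  (* For this factor [arcosh (k * u 0)] is exactly [eta]. At the other end scaling by [k > 1] only
     increases [arcosh], so a single [eta] is lost. *)
  specialize (Hk (cosh eta) Hc).
  rewrite U0, Rmult_1_r, arcosh_cosh in Hk by lra.
  enough (arcosh (u 1) <= arcosh (cosh eta * u 1)) by lra.
  assert (1 <= cosh eta * u 1) by nra.
  apply cosh_le_inv; [now apply arcosh_nonneg|].
  rewrite !cosh_arcosh by assumption. nra.
Qed.

(** The geodesic is [cosh (th t) p + sinh (th t) e], with [e] of Minkowski norm 1 and orthogonal to
    [p]; its speed is constantly [th]. *)
Lemma hyperboloid_geodesic (p q : R3) : hyperboloid p -> hyperboloid q ->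
  exists gamma, joins hyperboloid p q gamma /\
    arcosh (- minkowski_dot p q) = curve_length minkowski_form gamma.
Proof.
  intros Hp Hq.
  destruct (minkowski_dot_bound p q Hp Hq) as [Hge Heq].
  set (c := - minkowski_dot p q) in *. set (th := arcosh c).
  assert (Hth : 0 <= th) by now apply arcosh_nonneg.
  assert (Cth : cosh th = c) by now apply cosh_arcosh.
  assert (Hpz := proj2 Hp). assert (Hqz := proj2 Hq).
  destruct Hp as [Hp _], Hq as [Hq _]. unfold minkowski_form in Hp, Hq.
  assert (He : exists e, minkowski_form e = 1 /\ minkowski_dot p e = 0 /\
     cx q = cosh th * cx p + sinh th * cx e /\ cy q = cosh th * cy p + sinh th * cy e /\
     cz q = cosh th * cz p + sinh th * cz e).
  { destruct (Rle_lt_or_eq_dec _ _ Hge) as [Hlt|Hc1].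
    - assert (Hs2 := cosh2_sinh2 th). rewrite Cth in Hs2 |- *.
      assert (Hs : sinh th <> 0) by (intro Z; rewrite Z in Hs2; nra).
      set (s := sinh th) in *.
      (* Gram-Schmidt for the Minkowski form: [p] has form -1, so the coefficient of [p] is [c],
         minus the product of [p] and [q]; the remainder has form [c^2 - 1 = s^2]. *)
      exists (mkR3 ((cx q - c * cx p) / s) ((cy q - c * cy p) / s) ((cz q - c * cz p) / s)).
      unfold minkowski_form; unfold minkowski_dot in *; simpl cx; simpl cy; simpl cz.
      repeat split; try (field; lra).
      + replace (((cx q - c * cx p) / s) ^ 2 + ((cy q - c * cy p) / s) ^ 2 - ((cz q - c * cz p) / s) ^ 2)
          with ((cx q ^ 2 + cy q ^ 2 - cz q ^ 2 + 2 * c * - (cx p * cx q + cy p * cy q - cz p * cz q)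
             + c ^ 2 * (cx p ^ 2 + cy p ^ 2 - cz p ^ 2)) / s ^ 2) by (field; lra).
        rewrite Hp, Hq. fold c. replace (s ^ 2) with (c ^ 2 - 1) by lra.
        field. nra.
      + replace (cx p * ((cx q - c * cx p) / s) + cy p * ((cy q - c * cy p) / s) - cz p * ((cz q - c * cz p) / s))
          with ((- - (cx p * cx q + cy p * cy q - cz p * cz q) - c * (cx p ^ 2 + cy p ^ 2 - cz p ^ 2)) / s)
          by (field; lra).
        rewrite Hp. fold c. field; lra.
    - assert (p = q) by (apply Heq; unfold c in Hc1; lra).
      subst q.
      assert (T0 : th = 0) by (unfold th; rewrite <- Hc1, <- cosh_0; apply arcosh_cosh; lra).
      rewrite T0, cosh_0, sinh_0.
      (* any horizontal unit vector orthogonal to [p] does *)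
      destruct (Req_dec (cx p ^ 2 + cy p ^ 2) 0) as [E|E].
      + exists (mkR3 1 0 0). unfold minkowski_form, minkowski_dot; simpl.
        assert (cx p = 0) by nra. repeat split; lra.
      + set (r := sqrt (cx p ^ 2 + cy p ^ 2)).
        assert (Hr : r * r = cx p ^ 2 + cy p ^ 2) by (apply sqrt_sqrt; nra).
        assert (r <> 0) by (intro Z; rewrite Z in Hr; lra).
        exists (mkR3 (- cy p / r) (cx p / r) 0).
        unfold minkowski_form, minkowski_dot; simpl cx; simpl cy; simpl cz.
        repeat split; try (field; lra); try lra.
        replace ((- cy p / r) ^ 2 + (cx p / r) ^ 2 - 0 ^ 2) with ((cx p ^ 2 + cy p ^ 2) / (r * r))
          by (field; lra).
        rewrite Hr. field; lra. }
  destruct He as [e [He1 [He2 [Ex [Ey Ez]]]]].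
  exists (fun t => mkR3 (cosh (th * t) * cx p + sinh (th * t) * cx e)
                (cosh (th * t) * cy p + sinh (th * t) * cy e)
                (cosh (th * t) * cz p + sinh (th * t) * cz e)).
  assert (Hd : forall a b t, is_derive (fun t => cosh (th * t) * a + sinh (th * t) * b) t
     (th * (sinh (th * t) * a + cosh (th * t) * b)))
    by (intros; unfold cosh, sinh; auto_derive; [exact I|field]).
  assert (HD : forall a b t, Derive (fun t => cosh (th * t) * a + sinh (th * t) * b) t =
     th * (sinh (th * t) * a + cosh (th * t) * b))
    by (intros; apply is_derive_unique, Hd).
  assert (HC1 : forall a b, C1_function (fun t => cosh (th * t) * a + sinh (th * t) * b)).
  { intros a b t. split; [eexists; apply Hd|].
    eapply continuous_ext; [intro; symmetry; apply HD|].
    apply (ex_derive_continuous (V := R_NormedModule)).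
    unfold cosh, sinh. auto_derive. exact I. }
  unfold minkowski_form in He1; unfold minkowski_dot in He2.
  split; [split; [|split; [|split]]|].
  - split; [|split]; apply HC1.
  - intros t Ht. unfold hyperboloid, minkowski_form; simpl cx; simpl cy; simpl cz.
    assert (S := cosh2_sinh2 (th * t)).
    assert (S0 : 0 <= sinh (th * t)) by (apply sinh_nonneg; nra).
    split.
    + set (co := cosh (th * t)) in *; set (si := sinh (th * t)) in *.
      transitivity (co ^ 2 * (cx p ^ 2 + cy p ^ 2 - cz p ^ 2) + si ^ 2 * (cx e ^ 2 + cy e ^ 2 - cz e ^ 2)
        + 2 * co * si * (cx p * cx e + cy p * cy e - cz p * cz e)); [ring|].
      rewrite Hp, He1, He2. lra.
    (* The curve has to stay on the lower sheet. If [cz e > 0], the bounds [cz e < - cz p] and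
       [sinh < cosh] keep the negative term dominant. *)
    + destruct (Rle_lt_dec (cz e) 0) as [|Hez]; [pose proof (cosh_pos (th * t)); nra|].
      (* [cz e ^ 2 <= cz p ^ 2 - 1], by Cauchy-Schwarz, as [e] is unit and orthogonal to [p] *)
      assert (cz e < - cz p).
      { assert (cz e ^ 2 * cz p ^ 2 <= (cx p ^ 2 + cy p ^ 2) * (cx e ^ 2 + cy e ^ 2)).
        { replace (cz e ^ 2 * cz p ^ 2) with ((cx p * cx e + cy p * cy e) ^ 2)
            by (replace (cx p * cx e + cy p * cy e) with (cz p * cz e) by lra; ring).
          pose proof (pow2_ge_0 (cx p * cy e - cy p * cx e)); nra. }
        nra. }
      assert (sinh (th * t) < cosh (th * t))
        by (pose proof (cosh_sinh_exp_opp (th * t)); pose proof (exp_pos (- (th * t))); lra).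
      nra.
  - rewrite Rmult_0_r, cosh_0, sinh_0. apply R3_eq; simpl; ring.
  - rewrite Rmult_1_r. apply R3_eq; simpl; congruence.
  - symmetry. apply constant_speed_length; [exact Hth|].
    intro t. unfold velocity, minkowski_form; simpl cx; simpl cy; simpl cz. rewrite !HD.
    assert (S := cosh2_sinh2 (th * t)).
    set (co := cosh (th * t)) in *; set (si := sinh (th * t)) in *.
    transitivity (th ^ 2 * (si ^ 2 * (cx p ^ 2 + cy p ^ 2 - cz p ^ 2) + co ^ 2 * (cx e ^ 2 + cy e ^ 2 - cz e ^ 2)
      + 2 * co * si * (cx p * cx e + cy p * cy e - cz p * cz e))); [ring|].
    rewrite Hp, He1, He2. replace (si ^ 2 * -1 + co ^ 2 * 1 + 2 * co * si * 0) with 1 by lra. ring.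
Qed.

Lemma hyp_dist_arcosh (p q : R3) : hyperboloid p -> hyperboloid q ->
  hyp_dist p q = arcosh (- minkowski_dot p q).
Proof.
  intros Hp Hq. apply riemannian_dist_minimizer.
  - now apply hyperboloid_geodesic.
  - intros; now apply hyperboloid_length_ge.
Qed.

(** * The disc charts *)

Lemma Cmod_sqr (w : C) : Cmod w ^ 2 = fst w ^ 2 + snd w ^ 2.
Proof. unfold Cmod. apply pow2_sqrt. nra. Qed.

(** Second intersection of the hyperboloid [x^2 + y^2 - z^2 = -1] with the line through [(0,0,1)]
    and [w]; [sphere_lift] is the same for the sphere. *)
Definition hyp_lift (w : C) : R3 :=
  mkR3 (2 * fst w / (1 - Cmod w ^ 2)) (2 * snd w / (1 - Cmod w ^ 2))
       (- (1 + Cmod w ^ 2) / (1 - Cmod w ^ 2)).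

Definition sphere_lift (w : C) : R3 :=
  mkR3 (2 * fst w / (1 + Cmod w ^ 2)) (2 * snd w / (1 + Cmod w ^ 2))
       (- (1 - Cmod w ^ 2) / (1 + Cmod w ^ 2)).

Lemma Cmod_sqr_lt_1 (w : C) : Cmod w < 1 <-> Cmod w ^ 2 < 1.
Proof. pose proof (Cmod_ge_0 w). split; nra. Qed.

Lemma hyp_lift_hyperboloid (w : C) : Cmod w < 1 -> hyperboloid (hyp_lift w).
Proof.
  intro Hw. apply Cmod_sqr_lt_1 in Hw. unfold hyp_lift, hyperboloid, minkowski_form; simpl cx; simpl cy; simpl cz.
  pose proof (pow2_ge_0 (Cmod w)). split.
  - transitivity ((4 * (fst w ^ 2 + snd w ^ 2) - (1 + Cmod w ^ 2) ^ 2) / (1 - Cmod w ^ 2) ^ 2);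
      [field; lra|].
    rewrite <- Cmod_sqr. field; lra.
  - apply Rlt_div_l; lra.
Qed.

Lemma sphere_lift_hemisphere (w : C) : Cmod w < 1 -> south_hemisphere (sphere_lift w).
Proof.
  intro Hw. apply Cmod_sqr_lt_1 in Hw.
  unfold sphere_lift, south_hemisphere, sphere, euclid_form; simpl cx; simpl cy; simpl cz.
  pose proof (pow2_ge_0 (Cmod w)). split.
  - transitivity ((4 * (fst w ^ 2 + snd w ^ 2) + (1 - Cmod w ^ 2) ^ 2) / (1 + Cmod w ^ 2) ^ 2);
      [field; lra|].
    rewrite <- Cmod_sqr. field; lra.
  - apply Rlt_div_l; lra.
Qed.

Lemma proj_hyp_lift (w : C) : Cmod w < 1 -> proj (hyp_lift w) = w.
Proof.
  intro Hw. apply Cmod_sqr_lt_1 in Hw. unfold proj, hyp_lift; simpl cx; simpl cy; simpl cz.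
  destruct w as [x y]; cbn [fst snd]. f_equal; field; lra.
Qed.

Lemma proj_sphere_lift (w : C) : proj (sphere_lift w) = w.
Proof.
  pose proof (pow2_ge_0 (Cmod w)). unfold proj, sphere_lift; simpl cx; simpl cy; simpl cz.
  destruct w as [x y]; cbn [fst snd]. f_equal; field; lra.
Qed.

(** The equation of the surface eliminates [cx p] and [cy p] from the squared modulus of [proj p],
    which becomes a function of [cz p] alone. *)
Lemma hyp_lift_proj (p : R3) : hyperboloid p -> Cmod (proj p) < 1 /\ hyp_lift (proj p) = p.
Proof.
  intros [Hp Hz]. unfold minkowski_form in Hp.
  assert (E : Cmod (proj p) ^ 2 = (- cz p - 1) / (1 - cz p)).
  { rewrite Cmod_sqr. unfold proj; cbn [fst snd].
    transitivity ((cx p ^ 2 + cy p ^ 2) / (1 - cz p) ^ 2); [field; lra|].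
    replace (cx p ^ 2 + cy p ^ 2) with (cz p ^ 2 - 1) by lra. field; lra. }
  split.
  - apply Cmod_sqr_lt_1. rewrite E. apply Rlt_div_l; lra.
  - unfold hyp_lift. rewrite E. destruct p as [x y z]; unfold proj; simpl in *.
    f_equal; field; lra.
Qed.

Lemma sphere_lift_proj (p : R3) : south_hemisphere p -> Cmod (proj p) < 1 /\ sphere_lift (proj p) = p.
Proof.
  intros [Hp Hz]. unfold sphere, euclid_form in Hp.
  assert (E : Cmod (proj p) ^ 2 = (1 + cz p) / (1 - cz p)).
  { rewrite Cmod_sqr. unfold proj; cbn [fst snd].
    transitivity ((cx p ^ 2 + cy p ^ 2) / (1 - cz p) ^ 2); [field; lra|].
    replace (cx p ^ 2 + cy p ^ 2) with (1 - cz p ^ 2) by lra. field; lra. }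
  split.
  - apply Cmod_sqr_lt_1. rewrite E. apply Rlt_div_l; lra.
  - unfold sphere_lift. rewrite E. destruct p as [x y z]; unfold proj; simpl in *.
    f_equal; field; lra.
Qed.

Lemma chart_image_hyp_lift (A : R3 -> Prop) (w : C) : (forall p, A p -> hyperboloid p) ->
  chart_image A w <-> Cmod w < 1 /\ A (hyp_lift w).
Proof.
  intro HA. split.
  - intros [p [Hp <-]]. destruct (hyp_lift_proj p (HA p Hp)) as [H ->]. now split.
  - intros [H Hw]. exists (hyp_lift w). split; [exact Hw | now apply proj_hyp_lift].
Qed.

Lemma chart_image_sphere_lift (A : R3 -> Prop) (w : C) : (forall p, A p -> south_hemisphere p) ->
  chart_image A w <-> Cmod w < 1 /\ A (sphere_lift w).
Proof.
  intro HA. split.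
  - intros [p [Hp <-]]. destruct (sphere_lift_proj p (HA p Hp)) as [H ->]. now split.
  - intros [H Hw]. exists (sphere_lift w). split; [exact Hw | apply proj_sphere_lift].
Qed.

Lemma south_pole_hyp_lift : south_pole = hyp_lift 0.
Proof. unfold hyp_lift. rewrite Cmod_0. unfold south_pole. simpl. f_equal; field. Qed.

Lemma south_pole_sphere_lift : south_pole = sphere_lift 0.
Proof. unfold sphere_lift. rewrite Cmod_0. unfold south_pole. simpl. f_equal; field. Qed.

(** * Half-distance formulas in the disc *)

Definition hyp_d (w a : C) : R := hyp_dist (hyp_lift w) (hyp_lift a).
Definition sphere_d (w a : C) : R := sphere_dist (sphere_lift w) (sphere_lift a).

Lemma pow2_inj (x y : R) : 0 <= x -> 0 <= y -> x ^ 2 = y ^ 2 -> x = y.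
Proof. intros; nra. Qed.

(** The lifts give [cosh d = 1 + 2 |w - a|^2 / D^2]. Comparison with [cosh d = 1 + 2 sinh^2 (d/2)]
    yields the squares of both equations, and all terms are nonnegative. Keeping [D] as a factor
    avoids division. *)
Lemma hyp_d_half (w a : C) : Cmod w < 1 -> Cmod a < 1 ->
  0 <= hyp_d w a /\
  cosh (hyp_d w a / 2) * (sqrt (1 - Cmod w ^ 2) * sqrt (1 - Cmod a ^ 2)) = Cmod (1 - Cconj a * w) /\
  sinh (hyp_d w a / 2) * (sqrt (1 - Cmod w ^ 2) * sqrt (1 - Cmod a ^ 2)) = Cmod (w - a).
Proof.
  intros Hw Ha. pose proof (hyp_lift_hyperboloid w Hw) as Lw.
  pose proof (hyp_lift_hyperboloid a Ha) as La.
  destruct (minkowski_dot_bound _ _ Lw La) as [Hge _].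
  assert (Hd : 0 <= hyp_d w a)
    by (unfold hyp_d; rewrite hyp_dist_arcosh by assumption; now apply arcosh_nonneg).
  assert (Hc : cosh (hyp_d w a) = - minkowski_dot (hyp_lift w) (hyp_lift a))
    by (unfold hyp_d; rewrite hyp_dist_arcosh by assumption; now apply cosh_arcosh).
  apply Cmod_sqr_lt_1 in Hw, Ha.
  assert (Sw := pow2_sqrt (1 - Cmod w ^ 2) ltac:(lra)).
  assert (Sa := pow2_sqrt (1 - Cmod a ^ 2) ltac:(lra)).
  assert (Pw := sqrt_lt_R0 (1 - Cmod w ^ 2) ltac:(lra)).
  assert (Pa := sqrt_lt_R0 (1 - Cmod a ^ 2) ltac:(lra)).
  assert (E : - minkowski_dot (hyp_lift w) (hyp_lift a) * ((1 - Cmod w ^ 2) * (1 - Cmod a ^ 2)) =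
    (1 - Cmod w ^ 2) * (1 - Cmod a ^ 2) + 2 * Cmod (w - a) ^ 2).
  { unfold minkowski_dot, hyp_lift; cbn [cx cy cz].
    transitivity ((1 + Cmod w ^ 2) * (1 + Cmod a ^ 2) - 4 * (fst w * fst a + snd w * snd a)); [field; lra|].
    rewrite !Cmod_sqr. destruct w, a; simpl. ring. }
  assert (E2 : Cmod (1 - Cconj a * w) ^ 2 = (1 - Cmod w ^ 2) * (1 - Cmod a ^ 2) + Cmod (w - a) ^ 2)
    by (rewrite !Cmod_sqr; destruct w, a; simpl; ring).
  set (d := hyp_d w a) in *.
  assert (C2 : cosh d = cosh (d / 2) ^ 2 + sinh (d / 2) ^ 2)
    by (replace d with (d / 2 + d / 2) at 1 by field; rewrite cosh_add; ring).
  pose proof (cosh2_sinh2 (d / 2)) as I. rewrite <- Hc, C2 in E.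
  pose proof (cosh_pos (d / 2)). pose proof (sinh_nonneg (d / 2) ltac:(lra)).
  split; [exact Hd|]. set (D := sqrt (1 - Cmod w ^ 2) * sqrt (1 - Cmod a ^ 2)).
  assert (HD : D ^ 2 = (1 - Cmod w ^ 2) * (1 - Cmod a ^ 2))
    by (unfold D; rewrite Rpow_mult_distr, Sw, Sa; reflexivity).
  assert (0 < D) by (unfold D; nra).
  rewrite <- HD in E, E2.
  split; apply pow2_inj; try apply Cmod_ge_0; try nra; rewrite Rpow_mult_distr; nra.
Qed.

(** Same computation with [cos d = 1 - 2 sin^2 (d/2)]; the bound [d <= PI] makes [cos (d/2)] and
    [sin (d/2)] nonnegative, so that roots can be taken. *)
Lemma sphere_d_half (w a : C) : Cmod w < 1 -> Cmod a < 1 ->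
  0 <= sphere_d w a <= PI /\
  cos (sphere_d w a / 2) * (sqrt (1 + Cmod w ^ 2) * sqrt (1 + Cmod a ^ 2)) = Cmod (1 + Cconj a * w) /\
  sin (sphere_d w a / 2) * (sqrt (1 + Cmod w ^ 2) * sqrt (1 + Cmod a ^ 2)) = Cmod (w - a).
Proof.
  intros Hw Ha. destruct (sphere_lift_hemisphere w Hw) as [Lw Zw].
  destruct (sphere_lift_hemisphere a Ha) as [La Za].
  pose proof (sphere_dot_bound _ _ Lw La) as Hge.
  apply Cmod_sqr_lt_1 in Hw, Ha.
  pose proof (pow2_ge_0 (Cmod w)); pose proof (pow2_ge_0 (Cmod a)).
  (* Two points of the open southern hemisphere are never antipodal: the third coordinate of their
     sum is negative. *)
  assert (Hgt : -1 < sphere_dot (sphere_lift w) (sphere_lift a)).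
  { revert Lw La Zw Za. generalize (sphere_lift w) (sphere_lift a).
    unfold sphere, euclid_form, sphere_dot. intros p q Hp Hq Hpz Hqz.
    pose proof (pow2_ge_0 (cx p + cx q)); pose proof (pow2_ge_0 (cy p + cy q)). nra. }
  assert (Hd : 0 <= sphere_d w a <= PI)
    by (unfold sphere_d; rewrite sphere_dist_acos by assumption; apply acos_bound).
  assert (Hc : cos (sphere_d w a) = sphere_dot (sphere_lift w) (sphere_lift a))
    by (unfold sphere_d; rewrite sphere_dist_acos by assumption; now apply cos_acos).
  assert (Sw := pow2_sqrt (1 + Cmod w ^ 2) ltac:(lra)).
  assert (Sa := pow2_sqrt (1 + Cmod a ^ 2) ltac:(lra)).
  assert (Pw := sqrt_lt_R0 (1 + Cmod w ^ 2) ltac:(lra)).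
  assert (Pa := sqrt_lt_R0 (1 + Cmod a ^ 2) ltac:(lra)).
  assert (E : sphere_dot (sphere_lift w) (sphere_lift a) * ((1 + Cmod w ^ 2) * (1 + Cmod a ^ 2)) =
    (1 + Cmod w ^ 2) * (1 + Cmod a ^ 2) - 2 * Cmod (w - a) ^ 2).
  { unfold sphere_dot, sphere_lift; cbn [cx cy cz].
    transitivity ((1 - Cmod w ^ 2) * (1 - Cmod a ^ 2) + 4 * (fst w * fst a + snd w * snd a)); [field; lra|].
    rewrite !Cmod_sqr. destruct w, a; simpl. ring. }
  assert (E2 : Cmod (1 + Cconj a * w) ^ 2 = (1 + Cmod w ^ 2) * (1 + Cmod a ^ 2) - Cmod (w - a) ^ 2)
    by (rewrite !Cmod_sqr; destruct w, a; simpl; ring).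
  set (d := sphere_d w a) in *.
  assert (C2 : cos d = cos (d / 2) ^ 2 - sin (d / 2) ^ 2)
    by (replace d with (d / 2 + d / 2) at 1 by field; rewrite cos_plus; ring).
  pose proof (sin2_cos2 (d / 2)) as I. unfold Rsqr in I. rewrite <- Hc, C2 in E.
  pose proof (cos_ge_0 (d / 2) ltac:(lra) ltac:(lra)).
  pose proof (sin_ge_0 (d / 2) ltac:(lra) ltac:(lra)).
  split; [exact Hd|]. set (D := sqrt (1 + Cmod w ^ 2) * sqrt (1 + Cmod a ^ 2)).
  assert (HD : D ^ 2 = (1 + Cmod w ^ 2) * (1 + Cmod a ^ 2))
    by (unfold D; rewrite Rpow_mult_distr, Sw, Sa; reflexivity).
  assert (0 < D) by (unfold D; nra).
  rewrite <- HD in E, E2.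
  split; apply pow2_inj; try apply Cmod_ge_0; try nra; rewrite Rpow_mult_distr; nra.
Qed.

(** Sum of the two half-distance formulas at [a = 0], whose right-hand sides are 1 and [|w|]. *)
Lemma exp_half_hyp_d (w : C) : Cmod w < 1 ->
  exp (hyp_d w 0 / 2) * sqrt (1 - Cmod w ^ 2) = 1 + Cmod w.
Proof.
  intro Hw. destruct (hyp_d_half w 0 Hw) as [_ [Ec Es]]; [rewrite Cmod_0; lra|].
  rewrite <- cosh_sinh_exp.
  replace (1 - Cconj 0 * w)%C with (RtoC 1) in Ec
    by (destruct w; apply injective_projections; simpl; ring).
  replace (w - 0)%C with w in Es by ring.
  rewrite Cmod_1 in Ec. rewrite Cmod_0 in Ec, Es.
  replace (1 - 0 ^ 2) with 1 in Ec, Es by ring. rewrite sqrt_1 in Ec, Es. lra.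
Qed.

(** * The focal identities for the square map *)

Lemma Cmod_square (z : C) : Cmod (z * z) = Cmod z ^ 2.
Proof. rewrite Cmod_mult; ring. Qed.

Lemma Cmod_square_lt_1 (z : C) : Cmod (z * z) < 1 <-> Cmod z < 1.
Proof. rewrite Cmod_square. symmetry. apply Cmod_sqr_lt_1. Qed.

Lemma Cmod_sub_square (z b : C) : Cmod (z - b) * Cmod (z - - b) = Cmod (z * z - b * b).
Proof. rewrite <- Cmod_mult. f_equal; ring. Qed.

Lemma Cmod_one_sub_square (z b : C) :
  Cmod (1 - Cconj b * z) * Cmod (1 + Cconj b * z) = Cmod (1 - Cconj (b * b) * (z * z)).
Proof.
  rewrite <- Cmod_mult. f_equal. destruct z, b; apply injective_projections; simpl; ring.
Qed.

(** Put [E = exp ((d0 + alpha) / 2)]. The two half-distances have product of [cosh] equal to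
    [E cosh (da/2)] and product of [sinh] equal to [E sinh (da/2)]; the addition formulas then give
    [E exp (da/2)] and [E exp (- da/2)]. *)
Lemma hyp_focal_identities (z b : C) : Cmod z < 1 -> Cmod b < 1 ->
  let d0 := hyp_d (z * z) 0 in
  let da := hyp_d (z * z) (b * b) in
  let alpha := hyp_d (b * b) 0 in
  cosh ((hyp_d z b + hyp_d z (- b)) / 2) = exp ((d0 + da + alpha) / 2) /\
  cosh ((hyp_d z b - hyp_d z (- b)) / 2) = exp ((d0 - da + alpha) / 2).
Proof.
  intros Hz Hb d0 da alpha.
  assert (Hb' : Cmod (- b) < 1) by now rewrite Cmod_opp.
  destruct (hyp_d_half z b Hz Hb) as [_ [C1 S1]].
  destruct (hyp_d_half z (- b) Hz Hb') as [_ [C2 S2]].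
  assert (Hw := proj2 (Cmod_square_lt_1 z) Hz). assert (Ha := proj2 (Cmod_square_lt_1 b) Hb).
  destruct (hyp_d_half _ _ Hw Ha) as [_ [Ca Sa]]. fold da in Ca, Sa.
  assert (Ew := exp_half_hyp_d _ Hw). assert (Ea := exp_half_hyp_d _ Ha).
  fold d0 in Ew. fold alpha in Ea.
  replace (1 - Cconj (- b) * z)%C with (1 + Cconj b * z)%C in C2
    by (destruct z, b; apply injective_projections; simpl; ring).
  rewrite Cmod_opp in C2, S2.
  assert (C12 := f_equal2 Rmult C1 C2). assert (S12 := f_equal2 Rmult S1 S2).
  rewrite Cmod_one_sub_square, <- Ca in C12. rewrite Cmod_sub_square, <- Sa in S12.
  rewrite !Cmod_square in *.
  apply Cmod_sqr_lt_1 in Hz, Hb.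
  set (P := Cmod z ^ 2) in *. set (Q := Cmod b ^ 2) in *.
  assert (0 <= P) by apply pow2_ge_0. assert (0 <= Q) by apply pow2_ge_0.
  assert (Tz := pow2_sqrt (1 - P) ltac:(lra)). assert (Tb := pow2_sqrt (1 - Q) ltac:(lra)).
  assert (Tw := pow2_sqrt (1 - P ^ 2) ltac:(nra)). assert (Ta := pow2_sqrt (1 - Q ^ 2) ltac:(nra)).
  set (tz := sqrt (1 - P)) in *. set (tb := sqrt (1 - Q)) in *.
  set (tw := sqrt (1 - P ^ 2)) in *. set (ta := sqrt (1 - Q ^ 2)) in *.
  assert (HXY : exp (d0 / 2) * exp (alpha / 2) * (tw * ta) = (1 + P) * (1 + Q))
    by (rewrite <- Ew, <- Ea; ring).
  (* The normalising factors leave the quotient [tw ta / ((1 - P)(1 - Q))], which [HXY] identifies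
     with [E], since [(tw ta)^2 = (1 - P^2)(1 - Q^2)]. *)
  assert (K : forall x1 x2 y, x1 * (tz * tb) * (x2 * (tz * tb)) = y * (tw * ta) ->
    x1 * x2 = exp (d0 / 2) * exp (alpha / 2) * y).
  { intros x1 x2 y Hxy.
    apply Rmult_eq_reg_r with ((1 - P ^ 2) * (1 - Q ^ 2)).
    2: { apply Rmult_integral_contrapositive; split; nra. }
    transitivity (x1 * (tz * tb) * (x2 * (tz * tb)) * ((1 + P) * (1 + Q))).
    - transitivity (x1 * x2 * (tz ^ 2 * tb ^ 2) * ((1 + P) * (1 + Q))); [|ring].
      rewrite Tz, Tb; ring.
    - rewrite Hxy, <- HXY, <- Tw, <- Ta. ring. }
  apply K in C12. apply K in S12.
  replace ((hyp_d z b + hyp_d z (- b)) / 2) with (hyp_d z b / 2 + hyp_d z (- b) / 2) by field.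
  replace ((hyp_d z b - hyp_d z (- b)) / 2) with (hyp_d z b / 2 - hyp_d z (- b) / 2) by field.
  replace ((d0 + da + alpha) / 2) with (d0 / 2 + alpha / 2 + da / 2) by field.
  replace ((d0 - da + alpha) / 2) with (d0 / 2 + alpha / 2 + - (da / 2)) by field.
  rewrite cosh_add, cosh_sub, !exp_plus, <- cosh_sinh_exp_opp, <- (cosh_sinh_exp (da / 2)), C12, S12.
  split; ring.
Qed.

(** The spherical cosines and sines at [z] produce the hyperbolic functions of [da/2] at [z^2], now
    with factor [exp (- (d0 + alpha) / 2)]. The sign in [cos (x + y)] makes the sum correspond to
    [exp (- da/2)]. *)
Lemma sphere_focal_identities (z b : C) : Cmod z < 1 -> Cmod b < 1 ->
  let d0 := hyp_d (z * z) 0 in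
  let da := hyp_d (z * z) (b * b) in
  let alpha := hyp_d (b * b) 0 in
  cos ((sphere_d z b + sphere_d z (- b)) / 2) = exp (- (d0 + da + alpha) / 2) /\
  cos ((sphere_d z b - sphere_d z (- b)) / 2) = exp (- (d0 - da + alpha) / 2).
Proof.
  intros Hz Hb d0 da alpha.
  assert (Hb' : Cmod (- b) < 1) by now rewrite Cmod_opp.
  destruct (sphere_d_half z b Hz Hb) as [_ [C1 S1]].
  destruct (sphere_d_half z (- b) Hz Hb') as [_ [C2 S2]].
  assert (Hw := proj2 (Cmod_square_lt_1 z) Hz). assert (Ha := proj2 (Cmod_square_lt_1 b) Hb).
  destruct (hyp_d_half _ _ Hw Ha) as [_ [Ca Sa]]. fold da in Ca, Sa.
  assert (Ew := exp_half_hyp_d _ Hw). assert (Ea := exp_half_hyp_d _ Ha).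
  fold d0 in Ew. fold alpha in Ea.
  replace (1 + Cconj (- b) * z)%C with (1 - Cconj b * z)%C in C2
    by (destruct z, b; apply injective_projections; simpl; ring).
  rewrite Cmod_opp in C2, S2.
  (* [C2] comes first because on the sphere it is the focus [- b] that carries the factor
     [1 - Cconj b * z]. *)
  assert (C12 := f_equal2 Rmult C2 C1). assert (S12 := f_equal2 Rmult S1 S2).
  rewrite Cmod_one_sub_square, <- Ca in C12. rewrite Cmod_sub_square, <- Sa in S12.
  rewrite !Cmod_square in *.
  apply Cmod_sqr_lt_1 in Hz, Hb.
  set (P := Cmod z ^ 2) in *. set (Q := Cmod b ^ 2) in *.
  assert (0 <= P) by apply pow2_ge_0. assert (0 <= Q) by apply pow2_ge_0.
  assert (Tz := pow2_sqrt (1 + P) ltac:(lra)). assert (Tb := pow2_sqrt (1 + Q) ltac:(lra)).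
  assert (Pw := sqrt_lt_R0 (1 - P ^ 2) ltac:(nra)). assert (Pa := sqrt_lt_R0 (1 - Q ^ 2) ltac:(nra)).
  set (tz := sqrt (1 + P)) in *. set (tb := sqrt (1 + Q)) in *.
  set (tw := sqrt (1 - P ^ 2)) in *. set (ta := sqrt (1 - Q ^ 2)) in *.
  assert (HXY : exp (d0 / 2) * exp (alpha / 2) * (tw * ta) = (1 + P) * (1 + Q))
    by (rewrite <- Ew, <- Ea; ring).
  (* Here [(tz tb)^2 = (1 + P)(1 + Q)], so [HXY] directly gives the inverse of the hyperbolic
     factor. *)
  assert (K : forall x1 x2 y, x1 * (tz * tb) * (x2 * (tz * tb)) = y * (tw * ta) ->
    x1 * x2 = exp (- (d0 / 2) + - (alpha / 2)) * y).
  { intros x1 x2 y Hxy. pose proof (exp_pos (d0 / 2)); pose proof (exp_pos (alpha / 2)).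
    rewrite exp_plus, !exp_Ropp.
    apply Rmult_eq_reg_r with (exp (d0 / 2) * exp (alpha / 2) * (tw * ta)).
    2: { repeat apply Rmult_integral_contrapositive_currified; lra. }
    transitivity (y * (tw * ta)); [|field; lra].
    rewrite <- Hxy, HXY, <- Tz, <- Tb. ring. }
  apply K in C12. apply K in S12.
  replace ((sphere_d z b + sphere_d z (- b)) / 2) with (sphere_d z b / 2 + sphere_d z (- b) / 2) by field.
  replace ((sphere_d z b - sphere_d z (- b)) / 2) with (sphere_d z b / 2 - sphere_d z (- b) / 2) by field.
  replace (- (d0 + da + alpha) / 2) with (- (d0 / 2) + - (alpha / 2) + - (da / 2)) by field.
  replace (- (d0 - da + alpha) / 2) with (- (d0 / 2) + - (alpha / 2) + da / 2) by field.
  rewrite cos_plus, cos_minus, !(exp_plus (- (d0 / 2) + - (alpha / 2))), <- cosh_sinh_exp_opp,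
    <- (cosh_sinh_exp (da / 2)).
  rewrite (Rmult_comm (cos (sphere_d z b / 2))), C12, S12.
  split; ring.
Qed.

(** * Conic sections under the square map *)

(** The half-angle formulas give the absolute values [r] and [i] of the two parts; the sign of [y]
    decides that of the imaginary part. *)
Lemma complex_sqrt (a : C) : exists b : C, (b * b)%C = a.
Proof.
  destruct a as [x y]. set (m := Cmod (x, y)).
  assert (Hm : m ^ 2 = x ^ 2 + y ^ 2) by apply (Cmod_sqr (x, y)).
  assert (0 <= m) by apply Cmod_ge_0.
  assert (Hr := sqrt_sqrt ((m + x) / 2) ltac:(nra)).
  assert (Hi := sqrt_sqrt ((m - x) / 2) ltac:(nra)).
  set (r := sqrt ((m + x) / 2)) in *. set (i := sqrt ((m - x) / 2)) in *.
  assert (0 <= r) by apply sqrt_pos. assert (0 <= i) by apply sqrt_pos.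
  assert (Hri : 2 * (r * i) = Rabs y).
  { apply pow2_inj; [nra | apply Rabs_pos |].
    rewrite pow2_abs. transitivity (4 * (r * r) * (i * i)); [ring|]. rewrite Hr, Hi. lra. }
  destruct (Rle_lt_dec 0 y) as [Hy|Hy].
  - rewrite Rabs_pos_eq in Hri by lra. exists (r, i). apply injective_projections; simpl; lra.
  - rewrite Rabs_left in Hri by lra. exists (r, - i). apply injective_projections; simpl; lra.
Qed.

Lemma level_set_transfer {T : Type} (D : T -> Prop) (f g : T -> R) :
  (forall x, D x -> 0 <= g x) ->
  (forall x y, D x -> D y -> (f x = f y <-> g x = g y)) ->
  forall c, exists c', forall x, D x -> (f x = c <-> g x = c').
Proof.
  intros Hg Hfg c.
  destruct (classic (exists x, D x /\ f x = c)) as [[x [Hx <-]]|Hn].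
  - exists (g x). intros y Hy. now apply Hfg.
  (* An empty level set of [f] is matched with the value -1, which the nonnegative [g] never
     takes. *)
  - exists (-1). intros y Hy. split; intro E.
    + exfalso; apply Hn; now exists y.
    + specialize (Hg y Hy); lra.
Qed.

(** The sets [d(q,S) + eps d(q,A) = c] are the ellipses for [eps = 1] and the
    branches of hyperbolas for [eps = -1]. *)
Definition focal_level (A : R3) (eps c : R) (q : R3) : Prop :=
  hyperboloid q /\ hyp_dist q south_pole + eps * hyp_dist q A = c.

(** [A] is the focus other than the South pole. If the pole is [F2], the difference of distances
    changes sign, so the two branches of a hyperbola exchange their constants. *)
Lemma conic_branch_focal_level (F1 F2 : R3) : focused F1 F2 ->
  exists A, (A = F1 \/ A = F2) /\ (F1 <> F2 -> A <> south_pole) /\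
  forall B, is_conic_branch hyperboloid hyp_dist F1 F2 B ->
    exists eps c, (eps = 1 \/ eps = -1) /\ same_set B (focal_level A eps c).
Proof.
  unfold is_conic_branch, same_set, focal_level, ellipse, hyperbola_branch_pos, hyperbola_branch_neg.
  intros [-> | ->]; [exists F2 | exists F1]; (split; [tauto|split; [congruence|]]);
    intros B [c [HB|[_ [HB|HB]]]].
  - exists 1, c. split; [now left|]. intro q; rewrite HB, Rmult_1_l; reflexivity.
  - exists (-1), c. split; [now right|]. intro q; rewrite HB; split; intros [H E]; split; auto; lra.
  - exists (-1), (- c). split; [now right|]. intro q; rewrite HB; split; intros [H E]; split; auto; lra.
  - exists 1, c. split; [now left|]. intro q; rewrite HB; split; intros [H E]; split; auto; lra.
  - exists (-1), (- c). split; [now right|]. intro q; rewrite HB; split; intros [H E]; split; auto; lra.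
  - exists (-1), c. split; [now right|]. intro q; rewrite HB; split; intros [H E]; split; auto; lra.
Qed.

Lemma cosh_half_abs (x : R) : cosh (Rabs x / 2) = cosh (x / 2).
Proof.
  unfold Rabs; destruct (Rcase_abs x); [|reflexivity].
  replace (- x / 2) with (- (x / 2)) by field. apply cosh_opp.
Qed.

Lemma cos_half_abs (x : R) : cos (Rabs x / 2) = cos (x / 2).
Proof.
  unfold Rabs; destruct (Rcase_abs x); [|reflexivity].
  replace (- x / 2) with (- (x / 2)) by field. apply cos_neg.
Qed.

(** By the focal identities [cosh] of one side is [exp] of the other up to a shift independent of
    [z], and both functions are injective where used. The absolute value reflects that a preimage is
    invariant under [z -> - z], which swaps the foci: one branch pulls back to a whole hyperbola. *)
Lemma hyp_level_sets (b : C) (eps : R) : Cmod b < 1 -> eps = 1 \/ eps = -1 ->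
  forall c, exists c', forall z, Cmod z < 1 ->
  (hyp_d (z * z) 0 + eps * hyp_d (z * z) (b * b) = c <->
   Rabs (hyp_d z b + eps * hyp_d z (- b)) = c').
Proof.
  intros Hb Heps. apply level_set_transfer; [intros; apply Rabs_pos|].
  assert (K : forall z, Cmod z < 1 -> cosh (Rabs (hyp_d z b + eps * hyp_d z (- b)) / 2) =
    exp ((hyp_d (z * z) 0 + eps * hyp_d (z * z) (b * b) + hyp_d (b * b) 0) / 2)).
  { intros z Hz. destruct (hyp_focal_identities z b Hz Hb) as [I1 I2].
    rewrite cosh_half_abs. destruct Heps as [-> | ->].
    - rewrite !Rmult_1_l. exact I1.
    - replace (hyp_d z b + -1 * hyp_d z (- b)) with (hyp_d z b - hyp_d z (- b)) by ring.
      rewrite I2. f_equal; field. }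
  intros z z' Hz Hz'. pose proof (K z Hz) as E. pose proof (K z' Hz') as E'.
  split; intro H.
  - rewrite H, <- E' in E.
    apply cosh_inj in E; [lra| |]; (apply Rmult_le_pos; [apply Rabs_pos|lra]).
  - rewrite H, E' in E. apply exp_inv in E. lra.
Qed.

(** Here injectivity is that of [cos] on [[0, PI]], which contains half of any sum or absolute
    difference of two spherical distances. *)
Lemma sphere_level_sets (b : C) (eps : R) : Cmod b < 1 -> eps = 1 \/ eps = -1 ->
  forall c, exists c', forall z, Cmod z < 1 ->
  (hyp_d (z * z) 0 + eps * hyp_d (z * z) (b * b) = c <->
   Rabs (sphere_d z b + eps * sphere_d z (- b)) = c').
Proof.
  intros Hb Heps. apply level_set_transfer; [intros; apply Rabs_pos|].
  assert (K : forall z, Cmod z < 1 ->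
    0 <= Rabs (sphere_d z b + eps * sphere_d z (- b)) / 2 <= PI /\
    cos (Rabs (sphere_d z b + eps * sphere_d z (- b)) / 2) =
    exp (- (hyp_d (z * z) 0 + eps * hyp_d (z * z) (b * b) + hyp_d (b * b) 0) / 2)).
  { intros z Hz. destruct (sphere_focal_identities z b Hz Hb) as [I1 I2].
    assert (Hb' : Cmod (- b) < 1) by now rewrite Cmod_opp.
    destruct (sphere_d_half z b Hz Hb) as [B1 _]. destruct (sphere_d_half z (- b) Hz Hb') as [B2 _].
    rewrite cos_half_abs. split.
    - pose proof (Rabs_pos (sphere_d z b + eps * sphere_d z (- b))).
      enough (Rabs (sphere_d z b + eps * sphere_d z (- b)) <= 2 * PI) by lra.
      apply Rabs_le. destruct Heps as [-> | ->]; lra.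
    - destruct Heps as [-> | ->].
      + rewrite !Rmult_1_l. exact I1.
      + replace (sphere_d z b + -1 * sphere_d z (- b)) with (sphere_d z b - sphere_d z (- b)) by ring.
        rewrite I2. f_equal; field. }
  intros z z' Hz Hz'. destruct (K z Hz) as [B E]. destruct (K z' Hz') as [B' E'].
  split; intro H.
  - rewrite H, <- E' in E. apply cos_inj in E; lra.
  - rewrite H, E' in E. apply exp_inv in E. lra.
Qed.

Lemma is_conic_of_level (M : R3 -> Prop) (d : R3 -> R3 -> R) (F1 F2 : R3) (eps c : R) :
  (forall p, M p -> 0 <= d p F1 /\ 0 <= d p F2) -> eps = 1 \/ eps = -1 ->
  is_conic M d F1 F2 (fun p => M p /\ Rabs (d p F1 + eps * d p F2) = c).
Proof.
  intros Hd Heps. exists c. destruct Heps as [-> | ->]; [left|right]; intro p;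
    unfold ellipse, hyperbola; split; intros [Hp E]; split; auto; destruct (Hd p Hp);
    rewrite <- E; clear E.
  - rewrite Rabs_pos_eq; lra.
  - rewrite Rabs_pos_eq; lra.
  - f_equal; ring.
  - f_equal; ring.
Qed.

(** * Centering of the foci, and the final correspondence *)

Lemma hyp_centered (b : C) : Cmod b < 1 -> centered hyp_dist (hyp_lift b) (hyp_lift (- b)).
Proof.
  intro Hb. assert (Hb' : Cmod (- b) < 1) by now rewrite Cmod_opp.
  assert (H0 : Cmod 0 < 1) by (rewrite Cmod_0; lra).
  unfold centered, is_midpoint. rewrite south_pole_hyp_lift.
  fold (hyp_d 0 b) (hyp_d 0 (- b)) (hyp_d b (- b)).
  destruct (hyp_d_half b (- b) Hb Hb') as [P [E _]].
  rewrite Cmod_opp in E.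
  (* Only the modulus of [e] enters, so one computation serves both foci: the two sides have the
     common [cosh] equal to [(1 + |b|^2) / (1 - |b|^2)]. *)
  assert (K : forall e, Cmod e = Cmod b -> hyp_d 0 e = hyp_d b (- b) / 2).
  { intros e He. destruct (hyp_d_half 0 e H0 ltac:(lra)) as [P0 [E0 S0]].
    rewrite He in E0, S0.
    replace (1 - Cconj e * 0)%C with (RtoC 1) in E0 by ring.
    replace (0 - e)%C with (- e)%C in S0 by ring.
    rewrite Cmod_opp, He in S0. rewrite Cmod_0 in E0, S0. rewrite Cmod_1 in E0.
    replace (1 - 0 ^ 2) with 1 in E0, S0 by ring. rewrite sqrt_1, Rmult_1_l in E0, S0.
    replace (1 - Cconj (- b) * b)%C with (RtoC (1 + Cmod b ^ 2)) in E
      by (rewrite Cmod_sqr; destruct b; apply injective_projections; simpl; ring).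
    pose proof (pow2_ge_0 (Cmod b)).
    rewrite Cmod_R, Rabs_pos_eq in E by lra.
    apply cosh_inj; [exact P0 | lra |].
    replace (hyp_d 0 e) with (hyp_d 0 e / 2 + hyp_d 0 e / 2) by field.
    rewrite cosh_add.
    apply Cmod_sqr_lt_1 in Hb.
    assert (Q := sqrt_lt_R0 (1 - Cmod b ^ 2) ltac:(lra)).
    set (s := sqrt (1 - Cmod b ^ 2)) in *.
    apply Rmult_eq_reg_r with (s * s); [|nra]. rewrite E.
    transitivity ((cosh (hyp_d 0 e / 2) * s) ^ 2 + (sinh (hyp_d 0 e / 2) * s) ^ 2); [ring|].
    rewrite E0, S0; ring. }
  split; apply K; [reflexivity|apply Cmod_opp].
Qed.

Lemma sphere_centered (b : C) : Cmod b < 1 ->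
  centered sphere_dist (sphere_lift b) (sphere_lift (- b)).
Proof.
  intro Hb. assert (Hb' : Cmod (- b) < 1) by now rewrite Cmod_opp.
  assert (H0 : Cmod 0 < 1) by (rewrite Cmod_0; lra).
  unfold centered, is_midpoint. rewrite south_pole_sphere_lift.
  fold (sphere_d 0 b) (sphere_d 0 (- b)) (sphere_d b (- b)).
  destruct (sphere_d_half b (- b) Hb Hb') as [P [E _]].
  rewrite Cmod_opp in E.
  (* The common cosine is [(1 - |b|^2) / (1 + |b|^2)]. *)
  assert (K : forall e, Cmod e = Cmod b -> sphere_d 0 e = sphere_d b (- b) / 2).
  { intros e He. destruct (sphere_d_half 0 e H0 ltac:(lra)) as [P0 [E0 S0]].
    rewrite He in E0, S0.
    replace (1 + Cconj e * 0)%C with (RtoC 1) in E0 by ring.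
    replace (0 - e)%C with (- e)%C in S0 by ring.
    rewrite Cmod_opp, He in S0. rewrite Cmod_0 in E0, S0. rewrite Cmod_1 in E0.
    replace (1 + 0 ^ 2) with 1 in E0, S0 by ring. rewrite sqrt_1, Rmult_1_l in E0, S0.
    replace (1 + Cconj (- b) * b)%C with (RtoC (1 - Cmod b ^ 2)) in E
      by (rewrite Cmod_sqr; destruct b; apply injective_projections; simpl; ring).
    apply Cmod_sqr_lt_1 in Hb. pose proof (pow2_ge_0 (Cmod b)).
    rewrite Cmod_R, Rabs_pos_eq in E by lra.
    apply cos_inj; [exact P0 | lra |].
    replace (sphere_d 0 e) with (sphere_d 0 e / 2 + sphere_d 0 e / 2) by field.
    rewrite cos_plus.
    assert (Q := sqrt_lt_R0 (1 + Cmod b ^ 2) ltac:(lra)).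
    set (s := sqrt (1 + Cmod b ^ 2)) in *.
    apply Rmult_eq_reg_r with (s * s); [|nra]. rewrite E.
    transitivity ((cos (sphere_d 0 e / 2) * s) ^ 2 - (sin (sphere_d 0 e / 2) * s) ^ 2); [ring|].
    rewrite E0, S0; ring. }
  split; apply K; [reflexivity|apply Cmod_opp].
Qed.

Lemma focal_level_square_preimage (b : C) (eps c : R) (z : C) :
  square_preimage (chart_image (focal_level (hyp_lift (b * b)) eps c)) z <->
  Cmod z < 1 /\ hyp_d (z * z) 0 + eps * hyp_d (z * z) (b * b) = c.
Proof.
  unfold square_preimage. rewrite chart_image_hyp_lift by (intros p [Hp _]; exact Hp).
  unfold focal_level, hyp_d. rewrite south_pole_hyp_lift, Cmod_square_lt_1.
  split; [tauto|]. intros [Hz E]. repeat split; try assumption;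
    apply hyp_lift_hyperboloid, Cmod_square_lt_1, Hz.
Qed.

Theorem proposition10 (F1 F2 : R3)
    (hF1 : hyperboloid F1) (hF2 : hyperboloid F2) (hF : F1 <> F2)
    (hfocused : focused F1 F2) :
  exists G1 G2 H1 H2 : R3,
    (south_hemisphere G1 /\ south_hemisphere G2 /\ G1 <> G2 /\
     centered sphere_dist G1 G2) /\
    (hyperboloid H1 /\ hyperboloid H2 /\ H1 <> H2 /\
     centered hyp_dist H1 H2) /\
    (proj G1 = proj H1 /\ proj G2 = proj H2) /\
    forall B : R3 -> Prop, is_conic_branch hyperboloid hyp_dist F1 F2 B ->
      (exists K : R3 -> Prop,
         is_conic south_hemisphere sphere_dist G1 G2 K /\
         same_set (square_preimage (chart_image B)) (chart_image K)) /\
      (exists K : R3 -> Prop,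
         is_conic hyperboloid hyp_dist H1 H2 K /\
         same_set (square_preimage (chart_image B)) (chart_image K)).
Proof.
  destruct (conic_branch_focal_level F1 F2 hfocused) as [A [HA [HS HB]]].
  specialize (HS hF).
  assert (hA : hyperboloid A) by (destruct HA as [-> | ->]; assumption).
  destruct (hyp_lift_proj A hA) as [Ha EA].
  (* The new foci are the two square roots [b] and [- b] of the focus other than the pole. They
     depend only on [F1] and [F2], so they serve every branch of the family. *)
  destruct (complex_sqrt (proj A)) as [b Eb].
  rewrite <- Eb in Ha, EA.
  assert (Hb := proj1 (Cmod_square_lt_1 b) Ha).
  assert (Hb' : Cmod (- b) < 1) by now rewrite Cmod_opp.
  (* Otherwise [b + b] vanishes, hence [b * b] too, and [A] would be the South pole. *)
  assert (Hne : b <> (- b)%C).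
  { intro E. apply HS. rewrite <- EA, south_pole_hyp_lift. f_equal.
    replace (b * b)%C with (/ 2 * (b + b) * b)%C by (field; intro Z; injection Z; lra).
    rewrite E at 1. ring. }
  exists (sphere_lift b), (sphere_lift (- b)), (hyp_lift b), (hyp_lift (- b)).
  split; [|split; [|split]].
  - split; [|split; [|split]]; try (now apply sphere_lift_hemisphere); [|now apply sphere_centered].
    intro E. apply Hne. apply (f_equal proj) in E. now rewrite !proj_sphere_lift in E.
  - split; [|split; [|split]]; try (now apply hyp_lift_hyperboloid); [|now apply hyp_centered].
    intro E. apply Hne. apply (f_equal proj) in E. now rewrite !proj_hyp_lift in E.
  - rewrite !proj_sphere_lift, !proj_hyp_lift by assumption. now split.
  - intros B HBr. destruct (HB B HBr) as [eps [c [Heps EB]]].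
    (* The preimage becomes a single equation on the disc, from which both geometries are read
       off. *)
    assert (EP : forall z, square_preimage (chart_image B) z <->
      Cmod z < 1 /\ hyp_d (z * z) 0 + eps * hyp_d (z * z) (b * b) = c).
    { intro z. rewrite <- focal_level_square_preimage, EA.
      split; intros [p [Hp E]]; exists p; (split; [now apply EB|exact E]). }
    split.
    + destruct (sphere_level_sets b eps Hb Heps c) as [c' Hc'].
      eexists; split; [apply (is_conic_of_level _ _ _ _ eps c'); [|exact Heps]|].
      * intros p Hp. destruct (sphere_lift_proj p Hp) as [Hz <-].
        split; now apply sphere_d_half.
      * intro z. rewrite EP, chart_image_sphere_lift by tauto.
        fold (sphere_d z b) (sphere_d z (- b)).
        split; intros [Hz E]; (split; [exact Hz|]).
        -- split; [now apply sphere_lift_hemisphere | now apply Hc'].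
        -- now apply Hc', E.
    + destruct (hyp_level_sets b eps Hb Heps c) as [c' Hc'].
      eexists; split; [apply (is_conic_of_level _ _ _ _ eps c'); [|exact Heps]|].
      * intros p Hp. destruct (hyp_lift_proj p Hp) as [Hz <-].
        split; now apply hyp_d_half.
      * intro z. rewrite EP, chart_image_hyp_lift by tauto.
        fold (hyp_d z b) (hyp_d z (- b)).
        split; intros [Hz E]; (split; [exact Hz|]).
        -- split; [now apply hyp_lift_hyperboloid | now apply Hc'].
        -- now apply Hc', E.
Qed.
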